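(* The atomic singular inner function $S(z)=\exp\left(\frac{z+1}{z-1}\right)$ belongs to $\mathrm{BRV}\setminus H(H^\infty,H^\infty)$.
   Context: $\mathbb{D}$ is the open unit disc, $\mathbb{T}$ its boundary. $\mathrm{BRV}$ is the space of functions $g$ analytic in $\mathbb{D}$ with $\sup_{0\le\theta<2\pi}\int_0^1|g'(te^{i\theta})|\,dt<\infty$. $H^\infty$ is the space of bounded analytic functions in $\mathbb{D}$ with sup norm, identified with its boundary values in $L^\infty(\mathbb{T})$. Let $P$ be the Szeg\H{o} projection (orthogonal projection of $L^2(\mathbb{T})$ onto the Hardy space $H^2$), $P(f)(z)=\frac1{2\pi}\int_0^{2\pi}\frac{f(e^{i\theta})}{1-ze^{-i\theta}}\,d\theta$. For $\phi\in L^\infty(\mathbb{T})$ the Hankel operator is $H_\phi(f)=(I-P)(\phi f)$. A function $g\in H^\infty$ belongs to $H(H^\infty,H^\infty)$ if and only if $H_{\overline g}$ is bounded on $H^\infty$, i.e. there is $C>0$ with $\|H_{\overline g}(f)\|_{L^\infty(\mathbb{T})}\le C\|f\|_{H^\infty}$ for all $f\in H^\infty$. *)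

(* Defs.v *)
From HB Require Import structures.
From mathcomp Require Import all_boot all_order all_algebra complex.
From mathcomp Require Import all_classical all_reals all_analysis.
Set Implicit Arguments.
Unset Strict Implicit.
Unset Printing Implicit Defensive.
Import Order.TTheory GRing.Theory Num.Theory Normc.
Import numFieldNormedType.Exports.
Local Open Scope classical_set_scope.
Local Open Scope ring_scope.
Local Open Scope complex_scope.

(* R[i] as a normed module over itself: [derivable] and [derive1] on functions
   R[i] -> R[i] are then complex differentiability and the complex derivative. *)
HB.instance Definition _ (R : realType) := GRing.ComAlgebra.copy R[i] R[i]^o.
HB.instance Definition _ (R : realType) := Vector.copy R[i] R[i]^o.
HB.instance Definition _ (R : realType) := NormedModule.copy R[i] R[i]^o.

Section Disc.
Context {R : realType}.
Implicit Types (f g : R[i] -> R[i]) (u v : R -> R[i]) (z : R[i]) (t th : R).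

Definition expi th : R[i] := cos th +i* sin th.

Definition cexp z : R[i] := (expR (complex.Re z))%:C * expi (complex.Im z).

Definition disc : set R[i] := [set z | `|z| < 1].

Definition analytic_disc f := forall z, disc z -> derivable f z 1.

(* The derivative is only meaningful inside the disc, so the radius stops short
   of t = 1; a single point does not change the integral. *)
Definition radial_variation g th : \bar R :=
  (\int[lebesgue_measure]_(t in `[0%R, 1%R[)
     (normc (derive1 g (t%:C * expi th)))%:E)%E.

Definition BRV : set (R[i] -> R[i]) :=
  [set g | analytic_disc g /\
     (ereal_sup [set radial_variation g th | th in `[0%R, (2 * pi)%R[] < +oo)%E].

Definition Hinf_norm f : \bar R := ereal_sup [set (normc (f z))%:E | z in disc].

Definition Hinf : set (R[i] -> R[i]) :=
  [set f | analytic_disc f /\ (Hinf_norm f < +oo)%E].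

(* A function on the unit circle is represented by a function of the angle
   theta; only its values on [0, 2 pi] matter. *)

(* Radial boundary values.  For f in H^oo, and more generally in H^2, the limit
   exists for almost every theta (Fatou). *)
Definition boundary f : R -> R[i] :=
  fun th => lim (f (t%:C * expi th) @[t --> 1^'-]).

Definition cintegral (D : set R) u : R[i] :=
  (\int[lebesgue_measure]_(th in D) complex.Re (u th)) +i*
  (\int[lebesgue_measure]_(th in D) complex.Im (u th)).

Definition szego_ext u z : R[i] :=
  (2 * pi)^-1%:C *
  cintegral `[0, 2 * pi] (fun th => u th / (1 - z * expi (- th))).

Definition szego u : R -> R[i] := boundary (szego_ext u).

Definition hankel u v : R -> R[i] :=
  fun th => u th * v th - szego (fun s => u s * v s) th.

Definition circle_measure : {measure set (measurableTypeR R) -> \bar R} :=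
  mrestr (@lebesgue_measure R) (measurable_itv `[0%R, 2 * pi]).

Definition Linf_norm u : \bar R :=
  ('N[circle_measure]_+oo [EFin \o (@normc R \o u)])%E.

(* H(H^oo, H^oo): the g in H^oo for which the Hankel operator of symbol
   conj(g) is bounded from H^oo to L^oo of the circle. *)
Definition HHinf : set (R[i] -> R[i]) :=
  [set g | Hinf g /\
     exists C : R, 0 < C /\
       forall f, Hinf f ->
         (Linf_norm (hankel (fun th => ((boundary g th)^*)%C) (boundary f))
            <= C%:E * Hinf_norm f)%E].

Definition atomic_inner z : R[i] := cexp ((z + 1) / (z - 1)).

End Disc.

(* Main.v *)
Require Import Defs.
From HB Require Import structures.
From mathcomp Require Import all_boot all_order all_algebra complex.
From mathcomp Require Import all_classical all_reals all_analysis.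
From mathcomp Require Import measurable_realfun ess_sup_inf.
From mathcomp Require Import ring lra.
Set Implicit Arguments.
Unset Strict Implicit.
Unset Printing Implicit Defensive.
Import Order.TTheory GRing.Theory Num.Theory Normc.
Import numFieldNormedType.Exports.
Local Open Scope classical_set_scope.
Local Open Scope ring_scope.
Local Open Scope complex_scope.
(* Otherwise [^*] denotes [Num.conj] inside ring operations. *)
Local Notation "x ^*" := (conjc x) : ring_scope.

(** The sums of sin (k t) / k are bounded uniformly in their length, but their analytic half is a
    truncated logarithm, unbounded near 1: this is the failure of the Riesz projection on L^oo. The
    fixed symbol conj S shows it at every length because the exponential S has an inner root q of
    every order n, and on the circle conj S = conj q ^ n moves degrees centred at n to degrees
    centred at 0. Matching the order of the root with the length of the sum keeps q (0) ^ k above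
    exp (-1), so the divergence is seen at the interior point 0 and enters the Hankel image as a
    constant. Since S is discontinuous at 1, Cauchy's formula is needed for bounded functions with
    one bad boundary point: the circle is contracted to z inside the disc, and both ends of the
    contraction are reached by dominated convergence. In the variation bound, uniformity in a holds
    because exp (- s / 2a) / 2a has integral at most 1 over s > 0, whatever a > 0. *)

(* BRV: at [z = t e^(i th)] with [a = |1 - e^(i th)|^2] and [s = 1 - t], the derivative of
   the atomic inner function [S] is [O(1) + O(exp (- s / 2a) / a)], whose integral over
   [0 <= t < 1] is bounded independently of [a].

   Hankel operator: put [q = S ^ (1/n)] and let [f] be the sum over [1 <= k < n] of
   [(q ^ (n - k) - q ^ (n + k)) / k], a Fejer polynomial in [q], so that [|f| <= 6].  On the
   circle [conj S f = conj g - g], where [g] is the sum of the [q ^ k / k], so Cauchy's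
   formula shows that its Szego projection is [conj (g 0) - g], and the Hankel operator
   maps [f] to [conj g - conj (g 0)].  Now [g 0] is at least [exp (-1)] times a harmonic
   sum, while [|g| <= 2] on the arcs where [Re q < 0]. *)

(** * Complex derivatives *)

Section ComplexDerivative.
Context {R : realType}.
Implicit Types (z w : R[i]) (x y t : R) (f g : R[i] -> R[i]) (u v : R -> R[i]).

Lemma ltc_normc z x : (`|z| < x%:C) = (normc z < x).
Proof. exact: ltcR. Qed.

Lemma normc_ge0 z : 0 <= normc z.
Proof. by case: z => a b; rewrite /normc sqrtr_ge0. Qed.

Lemma normc_gt0 z : (0 < normc z) = (z != 0).
Proof.
rewrite lt_neqAle normc_ge0 andbT eq_sym; congr (~~ _); apply/eqP/eqP.
  exact: eq0_normc.
by move=> ->; rewrite normc0.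
Qed.

Lemma normc_real x : normc (x%:C) = `|x|.
Proof. by rewrite /normc /= expr0n addr0 sqrtr_sqr. Qed.

Lemma normcB z w : normc (z - w) = normc (w - z).
Proof. by rewrite -[LHS]normcN opprB. Qed.

Lemma normcX z n : normc (z ^+ n) = normc z ^+ n.
Proof. by elim: n => [|n IH]; rewrite ?expr0 ?normc1 // !exprS normcM IH. Qed.

Lemma ler_normcB z w : normc z - normc w <= normc (z - w).
Proof. by rewrite lerBlDr -{1}(subrK w z) le_normcD. Qed.

Lemma normc_conj z : normc z^* = normc z.
Proof. by case: z => a b /=; rewrite sqrrN. Qed.

Lemma normc_sum (I : Type) (r : seq I) (P : pred I) (F : I -> R[i]) :
  normc (\sum_(i <- r | P i) F i) <= \sum_(i <- r | P i) normc (F i).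
Proof.
elim/big_rec2: _ => [|i x z _ h]; first by rewrite normc0.
by apply: le_trans (le_normcD _ _) _; rewrite lerD2l.
Qed.

Lemma sqr_normcE z : normc z ^+ 2 = complex.Re z ^+ 2 + complex.Im z ^+ 2.
Proof.
case: z => a b /=; rewrite sqr_sqrtr //.
by rewrite addr_ge0 ?sqr_ge0.
Qed.

Lemma normRe_le z : `|complex.Re z| <= normc z.
Proof.
rewrite -(ler_pXn2r (n := 2)) ?nnegrE ?normc_ge0 // sqr_normcE real_normK ?num_real//.
by rewrite lerDl sqr_ge0.
Qed.

Lemma normIm_le z : `|complex.Im z| <= normc z.
Proof.
rewrite -(ler_pXn2r (n := 2)) ?nnegrE ?normc_ge0 // sqr_normcE real_normK ?num_real//.
by rewrite lerDr sqr_ge0.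
Qed.

Lemma normc_le_ReIm z : normc z <= `|complex.Re z| + `|complex.Im z|.
Proof.
rewrite -(ler_pXn2r (n := 2)) ?nnegrE ?normc_ge0 ?addr_ge0 // sqr_normcE.
rewrite sqrrD !real_normK ?num_real// lerD2r lerDl.
by rewrite mulrn_wge0 // mulr_ge0.
Qed.

Lemma cReB z w : complex.Re (z - w) = complex.Re z - complex.Re w.
Proof. by case: z; case: w. Qed.

Lemma cImB z w : complex.Im (z - w) = complex.Im z - complex.Im w.
Proof. by case: z; case: w. Qed.

Lemma cReMr x z : complex.Re (x%:C * z) = x * complex.Re z.
Proof. by case: z => a b /=; rewrite mul0r subr0. Qed.

Lemma cImMr x z : complex.Im (x%:C * z) = x * complex.Im z.
Proof. by case: z => a b /=; rewrite mul0r addr0. Qed.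

Lemma near_complexP z (P : set R[i]) :
  (\forall w \near z, P w) <->
  exists2 e : R, 0 < e & forall w, normc (z - w) < e -> P w.
Proof.
split.
  move=> /nbhs_ballP[[a b] /=]; rewrite ltcE /= => /andP[/eqP -> a0] h.
  exists a => // w wz; apply: h; rewrite /ball /= -/(_%:C).
  by rewrite ltc_normc.
move=> [e e0 h]; apply/nbhs_ballP; exists (e%:C) => /=; first by rewrite ltcR.
by move=> w; rewrite /ball /= ltc_normc; exact: h.
Qed.

Lemma cvg_complexP (T : Type) (F : set_system T) {FF : Filter F} (h : T -> R[i]) z :
  (h t @[t --> F] --> z) <->
  forall e : R, 0 < e -> \forall t \near F, normc (z - h t) < e.
Proof.
split=> H.
  move=> e e0; move/cvgrPdist_lt : H => /(_ (e%:C)); rewrite ltcR => /(_ e0).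
  by apply: filterS => t; rewrite ltc_normc.
apply/cvgrPdist_lt => -[a b]; rewrite ltcE /= => /andP[/eqP -> a0].
by have := H _ a0; apply: filterS => t; rewrite -/(_%:C) ltc_normc.
Qed.

Lemma cvg_Re (T : Type) (F : set_system T) {FF : Filter F} (h : T -> R[i]) z :
  h t @[t --> F] --> z -> complex.Re (h t) @[t --> F] --> complex.Re z.
Proof.
move=> /cvg_complexP H; apply/cvgrPdist_lt => e /H; apply: filterS => t.
by apply: le_lt_trans; rewrite -cReB normRe_le.
Qed.

Lemma cvg_Im (T : Type) (F : set_system T) {FF : Filter F} (h : T -> R[i]) z :
  h t @[t --> F] --> z -> complex.Im (h t) @[t --> F] --> complex.Im z.
Proof.
move=> /cvg_complexP H; apply/cvgrPdist_lt => e /H; apply: filterS => t.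
by apply: le_lt_trans; rewrite -cImB normIm_le.
Qed.

Lemma cvg_ReIm (T : Type) (F : set_system T) {FF : Filter F} (h : T -> R[i]) z :
  complex.Re (h t) @[t --> F] --> complex.Re z ->
  complex.Im (h t) @[t --> F] --> complex.Im z -> h t @[t --> F] --> z.
Proof.
move=> /cvgrPdist_lt HR /cvgrPdist_lt HI; apply/cvg_complexP => e e0.
have e20 : 0 < e / 2 by rewrite divr_gt0.
near=> t; apply: le_lt_trans (normc_le_ReIm _) _.
rewrite [e]splitr cReB cImB ltrD //; near: t; [exact: HR|exact: HI].
Unshelve. all: by end_near. Qed.

(* Complex and curve derivatives in epsilon form: the library's [is_derive] has no
   chain rule between maps over different fields ([R -> R[i]] and [R[i] -> R[i]]). *)
Definition cdiff f z d := forall e : R, 0 < e ->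
  \forall w \near z, normc (f w - f z - d * (w - z)) <= e * normc (w - z).

Definition vdiff u t d := forall e : R, 0 < e ->
  \forall s \near t, normc (u s - u t - d * (s - t)%:C) <= e * `|s - t|.

Lemma cdiff_continuous f z d : cdiff f z d -> {for z, continuous f}.
Proof.
move=> /(_ 1 ltr01) H; apply/(@cvg_complexP _ (nbhs z) _) => e e0.
have k0 : 0 < 1 + normc d by rewrite ltr_pwDl ?normc_ge0.
have Hn : \forall w \near z, normc (z - w) < e / (1 + normc d).
  by apply/near_complexP; exists (e / (1 + normc d)) => //; rewrite divr_gt0.
near=> w; rewrite normcB.
have -> : f w - f z = f w - f z - d * (w - z) + d * (w - z) by rewrite subrK.
apply: le_lt_trans (le_normcD _ _) _.
have H1 : normc (f w - f z - d * (w - z)) <= 1 * normc (w - z) by near: w.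
apply: le_lt_trans (lerD H1 (lexx _)) _.
rewrite normcM -mulrDl mulrC -ltr_pdivlMr // normcB.
by near: w.
Unshelve. all: by end_near. Qed.

Lemma vdiff_continuous u t d : vdiff u t d -> {for t, continuous u}.
Proof.
move=> /(_ 1 ltr01) H; apply/(@cvg_complexP _ (nbhs t) _) => e e0.
have k0 : 0 < 1 + normc d by rewrite ltr_pwDl ?normc_ge0.
have Hn : \forall s \near t, `|t - s| < e / (1 + normc d).
  by apply: (@nbhsx_ballx R R); rewrite divr_gt0.
near=> s; rewrite normcB.
have -> : u s - u t = u s - u t - d * (s - t)%:C + d * (s - t)%:C by rewrite subrK.
apply: le_lt_trans (le_normcD _ _) _.
have H1 : normc (u s - u t - d * (s - t)%:C) <= 1 * `|s - t| by near: s.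
apply: le_lt_trans (lerD H1 (lexx _)) _.
rewrite normcM normc_real -mulrDl mulrC -ltr_pdivlMr // distrC.
by near: s.
Unshelve. all: by end_near. Qed.

Lemma disc_normc z : disc z -> normc z < 1.
Proof. by rewrite /disc /= (_ : 1 = (1:R)%:C) // ltc_normc. Qed.

Lemma cdiff_cvg f z d : cdiff f z d ->
  h^-1 *: (f (h + z) - f z) @[h --> 0^'] --> d.
Proof.
move=> H; apply/cvg_complexP => e e0.
(* Half of [e], because [cdiff] gives a weak inequality and the limit asks for a strict one. *)
have := H (e / 2); rewrite divr_gt0 // => /(_ isT) /near_complexP[r r0 h].
have N : \forall k \near (0 : R[i])^', normc k < r.
  have r0' : 0 < r%:C by rewrite ltcR.
  by apply: filterS (dnbhs0_lt r0') => k; rewrite ltc_normc.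
near=> k.
have k0 : k != 0 by near: k; exact: nbhs_dnbhs_neq.
have := h (k + z); rewrite opprD addrCA subrr addr0 normcN addrK => /(_ _).
have -> : normc k < r by near: k.
move=> /(_ isT) hk.
rewrite /GRing.scale /=.
have -> : d - k^-1 * (f (k + z) - f z) =
   - (k^-1 * (f (k + z) - f z - d * k)) by field.
rewrite normcN normcM normcV mulrC ltr_pdivrMr ?normc_gt0 //.
apply: le_lt_trans hk _.
by rewrite ltr_pM2r ?normc_gt0 // ltr_pdivrMr // mulr_natr mulr2n ltrDl.
Unshelve. all: by end_near. Qed.

Lemma cdiff_derive1 f z d : cdiff f z d -> derive1 f z = d.
Proof. by move=> /cdiff_cvg H; apply/cvg_lim. Qed.

Lemma cdiff_derivable f z d : cdiff f z d -> derivable f z 1.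
Proof.
move=> /cdiff_cvg H; apply/cvg_ex; exists d => /=.
rewrite (_ : (fun e => _) = fun e : R[i] => e^-1 *: (f (e + z) - f z)); first by [].
by apply/funext => e; rewrite [e *: 1]mulr1.
Qed.

(** The passage to real calculus; imaginary parts are reached later as Re (- i w). *)
Lemma vdiff_is_derive_Re u t d : vdiff u t d ->
  is_derive t 1 (fun s => complex.Re (u s)) (complex.Re d).
Proof.
move=> H.
have C : h^-1 *: (complex.Re (u (h *: 1 + t)) - complex.Re (u t)) @[h --> 0^']
    --> complex.Re d.
  apply/cvgrPdist_lt => e e0.
  have := H (e / 2); rewrite divr_gt0 // => /(_ isT) /nbhs_ballP[r /= r0 h].
  have N : \forall k \near (0 : R)^', `|k| < r.
    by apply: dnbhs0_lt.
  near=> k.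
  have k0 : k != 0 by near: k; exact: nbhs_dnbhs_neq.
  have := h (k + t); rewrite /ball /= opprD addrCA subrr addr0 normrN addrK.
  have -> : `|k| < r by near: k.
  move=> /(_ isT) /(le_trans (normRe_le _)) hk.
  have -> : k *: 1 = k by rewrite /GRing.scale /= mulr1.
  rewrite /GRing.scale /=.
  rewrite !cReB mulrC cReMr in hk.
  have -> : complex.Re d - k^-1 * (complex.Re (u (k + t)) - complex.Re (u t)) =
     - (k^-1 * (complex.Re (u (k + t)) - complex.Re (u t) - k * complex.Re d)) by field.
  rewrite normrN normrM normfV mulrC ltr_pdivrMr ?normr_gt0 //.
  apply: le_lt_trans hk _.
  by rewrite ltr_pM2r ?normr_gt0 // ltr_pdivrMr // mulr_natr mulr2n ltrDl.
by apply: DeriveDef; [apply/cvg_ex; exists (complex.Re d)|apply/cvg_lim].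
Unshelve. all: by end_near. Qed.

Lemma cdiff_comp f g z d d' : cdiff f z d -> cdiff g (f z) d' ->
  cdiff (g \o f) z (d' * d).
Proof.
move=> Hf Hg e e0.
(* [k] is a local Lipschitz constant of [f], from tolerance 1; the summand 1 keeps the divisors
   positive when a derivative vanishes. Each of the two errors gets half of [e]. *)
pose k := 1 + normc d; have k0 : 0 < k by rewrite ltr_pwDl ?normc_ge0.
pose k' := 1 + normc d'; have k'0 : 0 < k' by rewrite ltr_pwDl ?normc_ge0.
have e1 : 0 < e / (2 * k) by rewrite divr_gt0 // mulr_gt0.
have e2 : 0 < e / (2 * k') by rewrite divr_gt0 // mulr_gt0.
have Hc := cdiff_continuous Hf.
have Hg' : \forall w \near z, normc (g (f w) - g (f z) - d' * (f w - f z)) <=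
    e / (2 * k) * normc (f w - f z) by exact: Hc (Hg _ e1).
have Hf1 := Hf _ ltr01; have Hf2 := Hf _ e2.
near=> w => /=.
have H1 : normc (f w - f z) <= k * normc (w - z).
  have -> : f w - f z = f w - f z - d * (w - z) + d * (w - z) by rewrite subrK.
  apply: le_trans (le_normcD _ _) _; rewrite normcM /k mulrDl lerD2r.
  by near: w.
have -> : g (f w) - g (f z) - d' * d * (w - z) =
  (g (f w) - g (f z) - d' * (f w - f z)) + d' * (f w - f z - d * (w - z)) by ring.
apply: le_trans (le_normcD _ _) _; rewrite normcM.
have -> : e * normc (w - z) = e / (2 * k) * (k * normc (w - z)) +
   k' * (e / (2 * k') * normc (w - z)) by field; rewrite !gt_eqF.
apply: lerD.
  apply: (@le_trans _ _ (e / (2 * k) * normc (f w - f z))); first by near: w.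
  by rewrite ler_pM2l.
apply: ler_pM; rewrite ?normc_ge0 //; first by rewrite /k' lerDr.
by near: w.
Unshelve. all: by end_near. Qed.

Lemma vdiff_comp u g t d d' : vdiff u t d -> cdiff g (u t) d' ->
  vdiff (g \o u) t (d' * d).
Proof.
move=> Hf Hg e e0.
pose k := 1 + normc d; have k0 : 0 < k by rewrite ltr_pwDl ?normc_ge0.
pose k' := 1 + normc d'; have k'0 : 0 < k' by rewrite ltr_pwDl ?normc_ge0.
have e1 : 0 < e / (2 * k) by rewrite divr_gt0 // mulr_gt0.
have e2 : 0 < e / (2 * k') by rewrite divr_gt0 // mulr_gt0.
have Hc := vdiff_continuous Hf.
have Hg' : \forall s \near t, normc (g (u s) - g (u t) - d' * (u s - u t)) <=
    e / (2 * k) * normc (u s - u t) by exact: Hc (Hg _ e1).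
have Hf1 := Hf _ ltr01; have Hf2 := Hf _ e2.
near=> s => /=.
have H1 : normc (u s - u t) <= k * `|s - t|.
  have -> : u s - u t = u s - u t - d * (s - t)%:C + d * (s - t)%:C by rewrite subrK.
  apply: le_trans (le_normcD _ _) _.
  rewrite [normc (_ * _)]normcM normc_real /k mulrDl lerD2r.
  by near: s.
have -> : g (u s) - g (u t) - d' * d * (s - t)%:C =
  (g (u s) - g (u t) - d' * (u s - u t)) + d' * (u s - u t - d * (s - t)%:C).
  by ring.
apply: le_trans (le_normcD _ _) _; rewrite normcM.
have -> : e * `|s - t| = e / (2 * k) * (k * `|s - t|) +
   k' * (e / (2 * k') * `|s - t|) by field; rewrite !gt_eqF.
apply: lerD.
  apply: (@le_trans _ _ (e / (2 * k) * normc (u s - u t))); first by near: s.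
  by rewrite ler_pM2l.
apply: ler_pM; rewrite ?normc_ge0 //; first by rewrite /k' lerDr.
by near: s.
Unshelve. all: by end_near. Qed.

End ComplexDerivative.

(** * Rules of complex differentiation and the exponential *)

Section ComplexExponential.
Context {R : realType}.
Implicit Types (z w : R[i]) (x y t : R) (f g : R[i] -> R[i]) (u v : R -> R[i]).

Lemma cdiff_near f g z d : (\forall w \near z, f w = g w) ->
  cdiff f z d -> cdiff g z d.
Proof.
move=> fg H e /H H'; have fz : f z = g z by move/nbhs_singleton : (fg).
near=> w => /=.
by have <- : f w = g w; [near: w|rewrite -fz; near: w].
Unshelve. all: by end_near. Qed.

Lemma cdiff_cst c z : cdiff (fun=> c) z 0.
Proof.
move=> e e0; apply: (@filterE _ (nbhs z)) => w.
by rewrite subrr mul0r subr0 normc0 mulr_ge0 ?normc_ge0 // ltW.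
Qed.

Lemma cdiff_id z : cdiff id z 1.
Proof.
move=> e e0; apply: (@filterE _ (nbhs z)) => w.
by rewrite mul1r subrr normc0 mulr_ge0 ?normc_ge0 // ltW.
Qed.

Lemma cdiffD f g z d d' : cdiff f z d -> cdiff g z d' ->
  cdiff (fun w => f w + g w) z (d + d').
Proof.
move=> Hf Hg e e0; have e20 : 0 < e / 2 by rewrite divr_gt0.
have H1 := Hg _ e20; have H2 := Hf _ e20; near=> w.
have -> : f w + g w - (f z + g z) - (d + d') * (w - z) =
  (f w - f z - d * (w - z)) + (g w - g z - d' * (w - z)) by ring.
apply: le_trans (le_normcD _ _) _.
by rewrite [e]splitr mulrDl lerD //; near: w.
Unshelve. all: by end_near. Qed.

Lemma cdiffZ c f z d : cdiff f z d -> cdiff (fun w => c * f w) z (c * d).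
Proof.
move=> Hf e e0; have k0 : 0 < 1 + normc c by rewrite ltr_pwDl ?normc_ge0.
have := Hf (e / (1 + normc c)); rewrite divr_gt0 // => /(_ isT) H1; near=> w.
have -> : c * f w - c * f z - c * d * (w - z) = c * (f w - f z - d * (w - z)).
  by ring.
rewrite normcM.
have -> : e * normc (w - z) = (1 + normc c) * (e / (1 + normc c) * normc (w - z)).
  by field; rewrite gt_eqF.
apply: ler_pM; rewrite ?normc_ge0 //; first by rewrite lerDr.
by near: w.
Unshelve. all: by end_near. Qed.

Lemma near_normcB_lt z (e : R) : 0 < e -> \forall w \near z, normc (z - w) < e.
Proof. by move=> e0; apply/near_complexP; exists e. Qed.

Lemma near_neq z w : z != w -> \forall w' \near z, w' != w.
Proof.
move=> zw; have : 0 < normc (z - w) by rewrite normc_gt0 subr_eq0.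
move/(near_normcB_lt z); apply: filterS => w'.
by apply: contraTneq => ->; rewrite ltxx.
Qed.

Lemma cdiff_inv z : z != 0 -> cdiff (fun w => w^-1) z (- z^-2).
Proof.
move=> z0 e e0; have nz0 : 0 < normc z by rewrite normc_gt0.
(* The first radius keeps |w| at least |z| / 2; the second then controls the remainder (w - z)^2 /
   (w z^2). *)
have H1 := @near_normcB_lt z (normc z / 2) (divr_gt0 nz0 (ltr0n _ 2)).
have e1 : 0 < e * normc z ^+ 3 / 2 by rewrite divr_gt0 // mulr_gt0 // exprn_gt0.
have H2 := near_normcB_lt z e1; have H3 := near_neq z0; near=> w.
have w0 : w != 0 by near: w.
have h1 : normc (z - w) < normc z / 2 by near: w.
have h2 : normc (z - w) < e * normc z ^+ 3 / 2 by near: w.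
have -> : w^-1 - z^-1 - - z^-2 * (w - z) = w^-1 * z^-2 * (w - z) * (w - z).
  by field; rewrite z0.
rewrite normcM; apply: ler_wpM2r; first exact: normc_ge0.
rewrite 2!normcM !normcV normcX normcB.
have hw : normc z / 2 <= normc w.
  have := ler_normcB z (z - w); rewrite opprB addrCA subrr addr0.
  by move=> h; lra.
have hw0 : 0 < normc w by rewrite normc_gt0.
rewrite -invfM mulrC ler_pdivrMr ?mulr_gt0 ?exprn_gt0 //.
apply: le_trans (ltW h2) _.
have -> : e * (normc w * normc z ^+ 2) = normc w * (e * normc z ^+ 2) by ring.
have -> : e * normc z ^+ 3 / 2 = (normc z / 2) * (e * normc z ^+ 2) by ring.
by apply: ler_wpM2r => //; rewrite mulr_ge0 ?exprn_ge0 ?normc_ge0 // ltW.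
Unshelve. all: by end_near. Qed.

Lemma near_is_derive (f : R -> R) t d : is_derive t 1 f d ->
  forall e, 0 < e -> \forall s \near t, `|f s - f t - d * (s - t)| <= e * `|s - t|.
Proof.
case=> df Df e e0.
have C : h^-1 *: (f (h *: 1 + t) - f t) @[h --> 0^'] --> d.
  by rewrite -Df; exact: df.
move/cvgrPdist_le : C => /(_ _ e0) /nbhs_ballP[r /= r0 h].
apply/nbhs_ballP; exists r => //= s; rewrite /ball /= => ts.
have [->|st] := eqVneq s t; first by rewrite !subrr mulr0 subr0 !normr0 mulr0.
have := h (s - t); rewrite /ball /= sub0r normrN (distrC s t) => /(_ ts).
rewrite subr_eq0 => /(_ st); rewrite /GRing.scale /= mulr1 subrK => hh.
have st0 : s - t != 0 by rewrite subr_eq0.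
have -> : f s - f t - d * (s - t) = - ((d - (s - t)^-1 * (f s - f t)) * (s - t)) by field.
by rewrite normrN normrM (distrC t) ler_pM2r ?normr_gt0.
Qed.

Lemma expiD x y : expi (x + y) = expi x * expi y.
Proof. by rewrite /expi cosD sinD; congr (_ +i* _); ring. Qed.

Lemma expi0 : expi 0 = 1 :> R[i].
Proof. by rewrite /expi cos0 sin0. Qed.

Lemma expiN x : expi (- x) = (expi x)^*.
Proof. by rewrite /expi cosN sinN. Qed.

Lemma normc_expi x : normc (expi x) = 1.
Proof. by rewrite /= cos2Dsin2 sqrtr1. Qed.

Lemma cexpD z w : cexp (z + w) = cexp z * cexp w.
Proof. by case: z w => [a b] [c d]; rewrite /cexp /= expRD expiD rmorphM /=; ring. Qed.

Lemma cexp0 : cexp 0 = 1 :> R[i].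
Proof. by rewrite /cexp /= expR0 expi0 mulr1. Qed.

Lemma normc_cexp z : normc (cexp z) = expR (complex.Re z).
Proof. by rewrite normcM normc_real normc_expi mulr1 ger0_norm ?expR_ge0. Qed.

Lemma cdiff_cexp0 : cdiff (@cexp R) 0 1.
Proof.
(* Six shares: the real and the imaginary part each have one error with factor 1 and one with factor
   [expR x], which is at most 2. *)
move=> e e0; have e6 : 0 < e / 6 by rewrite divr_gt0.
have /nbhs_ballP[r1 /= r10 h1] := near_is_derive (is_derive_expR 0) e6.
have /nbhs_ballP[r2 /= r20 h2] := near_is_derive (is_derive_cos 0) e6.
have /nbhs_ballP[r3 /= r30 h3] := near_is_derive (is_derive_sin 0) e6.
have ce : {for 0, continuous (@expR R)} by exact: continuous_expR.
have m60 : 0 < Num.min (e / 6) 1 by rewrite lt_min e6 ltr01.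
move/cvgrPdist_lt : ce => /(_ _ m60) /nbhs_ballP[r4 /= r40 h4].
pose r := Num.min (Num.min r1 r2) (Num.min r3 r4).
apply/near_complexP; exists r; first by rewrite /r !lt_min r10 r20 r30.
move=> w; rewrite sub0r normcN cexp0 mul1r subr0 => hr.
apply: le_trans (normc_le_ReIm _) _.
move: (normRe_le w) (normIm_le w); set N := normc w.
set x := complex.Re w; set y := complex.Im w => Nx Ny.
have -> : complex.Re (cexp w - 1 - w) = (expR x - 1 - x) + expR x * (cos y - 1).
  by rewrite !cReB /cexp /expi /= mul0r; ring.
have -> : complex.Im (cexp w - 1 - w) = expR x * (sin y - y) + (expR x - 1) * y.
  by rewrite !cImB /cexp /expi /= mul0r; ring.
have hx : `|x| < r by exact: le_lt_trans hr.
have hy : `|y| < r by exact: le_lt_trans hr.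
move: hx hy; rewrite /r !lt_min => /andP[/andP[x1 _] /andP[_ x4]] /andP[/andP[_ y2] /andP[y3 _]].
have := h1 x; rewrite /ball /= sub0r normrN subr0 expR0 mul1r => /(_ x1) {h1}h1.
have := h2 y; rewrite /ball /= sub0r normrN subr0 sin0 cos0 oppr0 mul0r subr0 => /(_ y2) {h2}h2.
have := h3 y; rewrite /ball /= sub0r normrN !subr0 sin0 cos0 subr0 mul1r => /(_ y3) {h3}h3.
have := h4 x; rewrite /ball /= sub0r normrN expR0 => /(_ x4) {h4}.
rewrite lt_min distrC => /andP[h4 h5].
have E2 : expR x <= 2 by move: h5; rewrite ltr_norml => /andP[]; lra.
have A1 : `|expR x - 1 - x + expR x * (cos y - 1)| <= e / 6 * N + 2 * (e / 6 * N).
  apply: le_trans (ler_normD _ _) _; apply: lerD.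
    by apply: le_trans h1 _; rewrite ler_pM2l.
  rewrite normrM ler_pM ?normr_ge0 //; first by rewrite ger0_norm ?expR_ge0.
  by apply: le_trans h2 _; rewrite ler_pM2l.
have A2 : `|expR x * (sin y - y) + (expR x - 1) * y| <= 2 * (e / 6 * N) + e / 6 * N.
  apply: le_trans (ler_normD _ _) _; rewrite !normrM; apply: lerD.
    rewrite ler_pM ?normr_ge0 //; first by rewrite ger0_norm ?expR_ge0.
    by apply: le_trans h3 _; rewrite ler_pM2l.
  by rewrite ler_pM ?normr_ge0 // ltW.
by apply: le_trans (lerD A1 A2) _; lra.
Qed.

(** The functional equation moves the point to 0: [cexp w] is [cexp z * cexp (- z + w)]. *)
Lemma cdiff_cexp z : cdiff (@cexp R) z (cexp z).
Proof.
have h : cdiff (fun w => -z + w) z 1.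
  rewrite -[1]add0r; apply: cdiffD; [exact: cdiff_cst|exact: cdiff_id].
have h0 : cdiff (@cexp R) (- z + z) 1 by rewrite addNr; exact: cdiff_cexp0.
have := cdiffZ (cexp z) (cdiff_comp h h0); rewrite !mulr1.
by apply: cdiff_near; apply: (@filterE _ (nbhs z)) => w /=; rewrite -cexpD addNKr.
Qed.

End ComplexExponential.

(** * Cauchy's formula on the circle *)

Section Homotopy.
Context {R : realType}.
Local Notation mu := (@lebesgue_measure R).
Implicit Types (a b s t r x y M : R).

Lemma integrable_bounded_oo (a b M : R) (f : R -> R) :
  measurable_fun `]a, b[%classic f ->
  (forall x, x \in `]a, b[ -> `|f x| <= M) ->
  mu.-integrable `]a, b[%classic (EFin \o f).
Proof.
move=> mf bf; apply: measurable_bounded_integrable => //.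
  by rewrite /= lebesgue_measure_itv /=; case: ifP => _; rewrite ?ltry // -EFinB ltry.
exists M; split; first exact: num_real.
by move=> N MN x abx; apply: le_trans (bf x _) (ltW MN).
Qed.

Lemma integrable_continuous_oo (a b M : R) (f : R -> R) :
  {in `]a, b[, continuous f} -> (forall x, x \in `]a, b[ -> `|f x| <= M) ->
  mu.-integrable `]a, b[%classic (EFin \o f).
Proof.
move=> cf; apply: integrable_bounded_oo; apply: open_continuous_measurable_fun.
  exact: interval_open.
by move=> x; rewrite inE /= => xab; exact: cf.
Qed.

Lemma Rintegral_derive_eq (a b : R) (f F : R -> R) : a < b -> continuous f ->
  (forall x : R, is_derive x 1 F (f x)) -> F a = F b ->
  \int[mu]_(x in `]a, b[) f x = 0.
Proof.
move=> ab cf dF Fab.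
have dF' x : derivable F x 1 by case: (dF x).
have cF x : {for x, continuous F} by apply/differentiable_continuous/derivable1_diffP.
rewrite /Rintegral -(integral_itv_bndoo true false); last first.
  apply/measurable_EFinP; apply: measurable_funTS.
  exact: continuous_measurable_fun.
rewrite (continuous_FTC2 (F := F)) //.
- by rewrite Fab -EFinB subrr.
- exact: continuous_subspaceT.
- split => //.
  + by apply: cvg_at_right_filter; exact: cF.
  + by apply: cvg_at_left_filter; exact: cF.
- by move=> x _; rewrite derive1E; case: (dF x).
Qed.

(** Dominated convergence with a constant majorant; the limit inherits measurability from the
    approximants, so it may be a mere boundary function. *)
Lemma cvg_Rintegral_bounded (a b M : R) (f_ : nat -> R -> R) (f : R -> R) :
  (forall n, continuous (f_ n)) -> (forall n x, `|f_ n x| <= M) ->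
  (forall x, x \in `]a, b[ -> f_ n x @[n --> \oo] --> f x) ->
  \int[mu]_(x in `]a, b[) f_ n x @[n --> \oo] --> \int[mu]_(x in `]a, b[) f x.
Proof.
move=> cf bf lf.
have mD : measurable `]a, b[%classic by exact: measurable_itv.
have fM x : x \in `]a, b[ -> `|f x| <= M.
  move=> xab; apply: (cvgr_to_le (cvg_norm (lf _ xab))).
  exact: nearW.
have mf : measurable_fun `]a, b[%classic f.
  apply: (@measurable_fun_cvg _ _ _ _ f_) => // n.
  apply: measurable_funTS; exact: continuous_measurable_fun.
apply: fine_cvg.
have If := integrable_bounded_oo mf fM.
rewrite /Rintegral fineK; last exact: integrable_fin_num.
apply: (@dominated_cvg _ _ _ _ _ _ _ _ (fun=> M%:E)) => //.
- move=> n; apply/measurable_EFinP; apply: measurable_funTS.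
  exact: continuous_measurable_fun.
- move=> x abx; apply: cvg_EFin; first exact: nearW.
  exact: lf.
- apply: integrable_bounded_oo => // x _; exact: lexx.
- by move=> n x _; rewrite lee_fin.
Qed.

(* The common derivative [dphi] of [phi] in [s] and of the periodic [psi] in [x] makes
   the integral of [phi s] independent of [s]. *)
Lemma homotopy_Rintegral (a b B : R) (phi dphi psi : R -> R -> R) (phi0 phi1 : R -> R) :
  a < b ->
  (forall s x : R, 0 < s < 1 -> is_derive s 1 (phi ^~ x) (dphi s x)) ->
  (forall s x : R, 0 < s < 1 -> is_derive x 1 (psi s) (dphi s x)) ->
  (forall s, 0 < s < 1 -> psi s a = psi s b) ->
  (forall s, 0 < s < 1 -> continuous (phi s)) ->
  (forall s, 0 < s < 1 -> continuous (dphi s)) ->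
  (forall s x, 0 < s < 1 -> `|phi s x| <= B) ->
  (forall r, 0 < r < 1 -> exists M, forall s x, 0 < s < r -> `|dphi s x| <= M) ->
  (forall x, x \in `]a, b[ -> phi s x @[s --> 0^'+] --> phi0 x) ->
  (forall x, x \in `]a, b[ -> phi s x @[s --> 1^'-] --> phi1 x) ->
  \int[mu]_(x in `]a, b[) phi0 x = \int[mu]_(x in `]a, b[) phi1 x.
Proof.
move=> ab d1 d2 per cphi cdphi bphi bdphi l0 l1.
pose F s := \int[mu]_(x in `]a, b[) phi s x.
have dF s : 0 < s < 1 -> is_derive s 1 F 0.
  move=> /andP[s0 s1].
  (* [dphi] may blow up as its parameter tends to 1, so the majorant for differentiating under the
     integral is taken on []0, r[], with [r] halfway between [s] and 1. *)
  pose r := (s + 1) / 2.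
  have r1 : 0 < r < 1 by rewrite /r; apply/andP; split; lra.
  have sr : s < r by rewrite /r; lra.
  have [M HM] := bdphi _ r1.
  have I x : `]0, r[%classic x -> 0 < x < 1.
    by rewrite /= in_itv /= => /andP[-> xr]; case/andP: r1 => _ /(lt_trans xr).
  have Is : `]0, r[%classic s by rewrite /= in_itv /= s0.
  have mD : measurable (`]a, b[%classic : set (measurableTypeR R)) by exact: measurable_itv.
  have intf x : `]0, r[%classic x -> mu.-integrable `]a, b[ (EFin \o phi x).
    move=> /I Ix; apply: (@integrable_continuous_oo _ _ B) => [y _|y _].
      exact: cphi.
    exact: bphi.
  have derf x y : `]0, r[%classic x -> `]a, b[%classic y -> derivable (phi ^~ y) x 1.
    by move=> /I Ix _; case: (d1 _ y Ix).
  have p1 x y : 0 < x < 1 -> partial1of2 phi x y = dphi x y.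
    by move=> Ix; rewrite partial1of2E; case: (d1 _ y Ix).
  have M0 : 0 <= M.
    by apply: le_trans (HM s a _); rewrite ?normr_ge0 // s0 sr.
  have intG : mu.-integrable `]a, b[ (EFin \o (fun=> M)).
    by apply: (@integrable_continuous_oo _ _ M) => x _; [exact: cvg_cst|rewrite ger0_norm].
  have Gub x y : `]0, r[%classic x -> `]a, b[%classic y -> `|partial1of2 phi x y| <= M.
    by move=> Ix _; rewrite p1; [exact: HM|exact: I].
  have D := derivable_under_integral mD Is intf derf (fun=> M0) intG Gub.
  have E := differentiation_under_integral mD Is intf derf (fun=> M0) intG Gub.
  apply: DeriveDef; first exact: D.
  rewrite -derive1E E.
  under eq_Rintegral do rewrite p1 ?s0 ?s1 //.
  have s01 : 0 < s < 1 by rewrite s0.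
  exact: (Rintegral_derive_eq ab (cdphi _ s01) (fun x => d2 _ x s01) (per _ s01)).
have cstF s t : 0 < s < 1 -> 0 < t < 1 -> s < t -> F s = F t.
  move=> /andP[s0 s1] /andP[t0 t1] st.
  have [||c _] := @MVT _ F (fun=> 0) s t st.
  - move=> x; rewrite in_itv /= => /andP[sx xt]; apply: dF.
    by rewrite (lt_trans s0) // (lt_trans xt).
  - apply: derivable_within_continuous => x; rewrite in_itv /= => /andP[sx xt].
    by case: (dF x); rewrite // (lt_le_trans s0) // (le_lt_trans xt).
  - by rewrite mul0r => /eqP; rewrite subr_eq0 => /eqP.
have h2 : 0 < (2^-1 : R) < 1 by apply/andP; split; lra.
have cF s : 0 < s < 1 -> F s = F 2^-1.
  move=> s01; have [sh|hs|->//] := ltgtP s 2^-1; first exact: cstF.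
  by apply/esym; exact: cstF.
(* The shift by 2 keeps this sequence strictly between 0 and 1 from [n = 0] on; it and its
   reflection in 1/2 approach the two ends. *)
have u01 n : 0 < (n.+2%:R^-1 : R) < 1.
  by rewrite invr_gt0 ltr0n /= invf_lt1 ?ltr0n // ltr1n.
have cvgu : (n.+2%:R^-1 : R) @[n --> \oo] --> 0.
  by have := @cvg_harmonic R; rewrite -(cvg_shiftS (@harmonic R)).
have key (u : nat -> R) (f : R -> R) : (forall n, 0 < u n < 1) ->
    (forall x, x \in `]a, b[ -> phi (u n) x @[n --> \oo] --> f x) ->
    \int[mu]_(x in `]a, b[) f x = F 2^-1.
  move=> u1 ul.
  have C := @cvg_Rintegral_bounded a b B (fun n => phi (u n)) f (fun n => cphi _ (u1 n))
     (fun n x => bphi _ x (u1 n)) ul.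
  apply/esym; apply: cvg_unique C; first exact: norm_hausdorff.
  have -> : (fun n => \int[mu]_(x in `]a, b[) phi (u n) x) = (fun=> F 2^-1).
    by apply/funext => n; exact: cF.
  exact: cvg_cst.
have -> : \int[mu]_(x in `]a, b[) phi0 x = F 2^-1.
  apply: (key _ _ u01) => x xab; have /cvg_at_rightP := l0 _ xab; apply; split => //.
apply/esym; apply: (key (fun n => 1 - n.+2%:R^-1)) => [n|x xab].
  by move: (u01 n); move: (_^-1) => v /andP[? ?]; apply/andP; split; lra.
have /cvg_at_leftP := l1 _ xab; apply; split.
  by move=> n; move: (u01 n); move: (_^-1) => v /andP[? ?]; lra.
rewrite -[X in _ --> X]subr0; apply: cvgB => //; exact: cvg_cst.
Qed.

End Homotopy.

(** * Bounded analytic functions, continuous at the circle except at 1 *)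

Section HardyClass.
Context {R : realType}.
Implicit Types (z w a : R[i]) (x y t : R) (f g h : R[i] -> R[i]) (u v : R -> R[i]).

Lemma cdiff_sqr z : cdiff (fun w => w ^+ 2) z (2 * z).
Proof.
move=> e e0; have H := near_normcB_lt z e0; near=> w.
have -> : w ^+ 2 - z ^+ 2 - 2 * z * (w - z) = (w - z) * (w - z) by ring.
rewrite normcM; apply: ler_wpM2r; first exact: normc_ge0.
by rewrite normcB ltW //; near: w.
Unshelve. all: by end_near. Qed.

(** Polarization: f g is ((f + g)^2 - (f - g)^2) / 4, so sums, the chain rule and the square
    suffice. *)
Lemma cdiffM f g z d d' : cdiff f z d -> cdiff g z d' ->
  cdiff (fun w => f w * g w) z (d * g z + f z * d').
Proof.
move=> df dg.
have dp := cdiff_comp (cdiffD df dg) (cdiff_sqr _).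
have dm := cdiff_comp (cdiffD df (cdiffZ (-1) dg)) (cdiff_sqr _).
have := cdiffZ (4^-1) (cdiffD dp (cdiffZ (-1) dm)).
rewrite (_ : 4^-1 * _ = d * g z + f z * d'); last by field.
by apply: cdiff_near; apply: (@filterE _ (nbhs z)) => w /=; field.
Qed.

Lemma cReD z w : complex.Re (z + w) = complex.Re z + complex.Re w.
Proof. by case: z; case: w. Qed.

Lemma cImD z w : complex.Im (z + w) = complex.Im z + complex.Im w.
Proof. by case: z; case: w. Qed.

Lemma cReM z w : complex.Re (z * w) =
  complex.Re z * complex.Re w - complex.Im z * complex.Im w.
Proof. by case: z; case: w. Qed.

Lemma cImM z w : complex.Im (z * w) =
  complex.Re z * complex.Im w + complex.Im z * complex.Re w.
Proof. by case: z => a b; case: w => c d. Qed.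

Lemma continuous_ccst (T : topologicalType) (s : T) (c : R[i]) :
  {for s, continuous (fun=> c)}.
Proof. exact: cst_continuous. Qed.

Lemma continuous_cM (T : topologicalType) (p q : T -> R[i]) (s : T) :
  {for s, continuous p} -> {for s, continuous q} ->
  {for s, continuous (fun r => p r * q r)}.
Proof.
move=> cp cq; have [pR pI] := (cvg_Re cp, cvg_Im cp).
have [qR qI] := (cvg_Re cq, cvg_Im cq).
apply: cvg_ReIm; rewrite ?cReM ?cImM.
  under eq_fun do rewrite cReM.
  by apply: cvgB; apply: cvgM.
under eq_fun do rewrite cImM.
by apply: cvgD; apply: cvgM.
Qed.

Lemma continuous_cD (T : topologicalType) (p q : T -> R[i]) (s : T) :
  {for s, continuous p} -> {for s, continuous q} ->
  {for s, continuous (fun r => p r + q r)}.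
Proof.
move=> cp cq; have [pR pI] := (cvg_Re cp, cvg_Im cp).
have [qR qI] := (cvg_Re cq, cvg_Im cq).
apply: cvg_ReIm; rewrite ?cReD ?cImD.
  under eq_fun do rewrite cReD.
  exact: cvgD.
under eq_fun do rewrite cImD.
exact: cvgD.
Qed.

Lemma continuous_cV (T : topologicalType) (p : T -> R[i]) (s : T) :
  {for s, continuous p} -> p s != 0 ->
  {for s, continuous (fun r => (p r)^-1)}.
Proof. by move=> cp /cdiff_inv /cdiff_continuous cf; exact: cvg_comp cp cf. Qed.

(* [h] is the derivative of [g].  The Cauchy-type bound on [h] is the natural one that
   is stable under products, and continuity is required at all boundary points but
   [1], the singularity of the atomic inner function. *)
Record hardy g h (B M : R) : Prop := Hardy {
  hardy_cdiff : forall z, normc z < 1 -> cdiff g z (h z);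
  hardy_cont : forall z, normc z < 1 -> {for z, continuous h};
  hardy_le : forall z, normc z < 1 -> normc (g z) <= B;
  hardy_deriv_le : forall z, normc z < 1 -> normc (h z) * (1 - normc z) ^+ 2 <= M;
  hardy_boundary : forall z, normc z = 1 -> z != 1 -> {for z, continuous g} }.

Lemma hardyM g h B M g' h' B' M' : hardy g h B M -> hardy g' h' B' M' ->
  hardy (fun z => g z * g' z) (fun z => h z * g' z + g z * h' z)
    (B * B') (M * B' + B * M').
Proof.
move=> [d c b db e] [d' c' b' db' e']; split.
- by move=> z z1; apply: cdiffM; [exact: d|exact: d'].
- move=> z z1; apply: continuous_cD; apply: continuous_cM.
  + exact: c.
  + exact: cdiff_continuous (d' _ z1).
  + exact: cdiff_continuous (d _ z1).
  + exact: c'.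
- by move=> z z1; rewrite normcM ler_pM ?normc_ge0 ?b ?b'.
- move=> z z1; apply: (@le_trans _ _
    ((normc (h z) * normc (g' z) + normc (g z) * normc (h' z)) * (1 - normc z) ^+ 2)).
    apply: ler_wpM2r; first exact: sqr_ge0.
    by rewrite -!normcM le_normcD.
  have q0 : 0 <= (1 - normc z) ^+ 2 by exact: sqr_ge0.
  rewrite mulrDl; apply: lerD.
    rewrite mulrAC; apply: ler_pM; rewrite ?normc_ge0 ?(mulr_ge0 (normc_ge0 _)) //.
      exact: db.
    exact: b'.
  rewrite -mulrA; apply: ler_pM; rewrite ?normc_ge0 ?(mulr_ge0 (normc_ge0 _)) //.
    exact: b.
  exact: db'.
- by move=> z z1 zn1; apply: continuous_cM; [exact: e|exact: e'].
Qed.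

Lemma hardyD g h B M g' h' B' M' : hardy g h B M -> hardy g' h' B' M' ->
  hardy (fun z => g z + g' z) (fun z => h z + h' z) (B + B') (M + M').
Proof.
move=> [d c b db e] [d' c' b' db' e']; split.
- by move=> z z1; apply: cdiffD; [exact: d|exact: d'].
- by move=> z z1; apply: continuous_cD; [exact: c|exact: c'].
- by move=> z z1; apply: le_trans (le_normcD _ _) _; rewrite lerD ?b ?b'.
- move=> z z1; apply: (@le_trans _ _ ((normc (h z) + normc (h' z)) * (1 - normc z) ^+ 2)).
    by apply: ler_wpM2r; [exact: sqr_ge0|exact: le_normcD].
  by rewrite mulrDl lerD ?db ?db'.
- by move=> z z1 zn1; apply: continuous_cD; [exact: e|exact: e'].
Qed.

Lemma hardy_cst c : hardy (fun=> c) (fun=> 0) (normc c) 0.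
Proof.
split.
- by move=> z _; exact: cdiff_cst.
- by move=> z _; exact: continuous_ccst.
- by [].
- by move=> z _; rewrite normc0 mul0r.
- by move=> z _ _; exact: continuous_ccst.
Qed.

Lemma hardyZ c g h B M : hardy g h B M ->
  hardy (fun z => c * g z) (fun z => 0 * g z + c * h z) (normc c * B) (0 * B + normc c * M).
Proof. exact/hardyM/hardy_cst. Qed.

Lemma hardy_sum (I : Type) (r : seq I) (g : I -> R[i] -> R[i]) :
  (forall i, exists h B M, hardy (g i) h B M) ->
  exists h B M, hardy (fun z => \sum_(i <- r) g i z) h B M.
Proof.
move=> H; elim: r => [|i r [h [B [M IH]]]].
  exists (fun=> 0), (normc 0), 0.
  rewrite (_ : (fun _ => _) = fun=> 0); first exact: hardy_cst.
  by apply/funext => z; rewrite big_nil.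
have [h' [B' [M' Hi]]] := H i.
exists (fun z => h' z + h z), (B' + B), (M' + M).
rewrite (_ : (fun _ => _) = fun z => g i z + \sum_(j <- r) g j z); first exact: hardyD.
by apply/funext => z; rewrite big_cons.
Qed.

Lemma normc_subr1_gt0 a : normc a < 1 -> 1 - a != 0.
Proof.
by move=> a1; rewrite subr_eq0; apply: contraTneq a1 => <-; rewrite normc1 ltxx.
Qed.

Lemma normc1B_ge a : 1 - normc a <= normc (1 - a).
Proof. by have := ler_normcB 1 a; rewrite normc1. Qed.

Lemma cdiff_affine a b z : cdiff (fun w => a + b * w) z b.
Proof.
rewrite -[b in cdiff _ _ b]add0r -[b in 0 + b]mulr1; apply: cdiffD; first exact: cdiff_cst.
by apply: cdiffZ; exact: cdiff_id.
Qed.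

Lemma cdiff_kernel a z : 1 - a * z != 0 ->
  cdiff (fun w => (1 - a * w)^-1) z (a * (1 - a * z) ^- 2).
Proof.
move=> az.
have az' : 1 + - a * z != 0 by rewrite mulNr.
have := cdiff_comp (cdiff_affine 1 (- a) z) (cdiff_inv az').
rewrite (_ : - _ * _ = a * (1 - a * z) ^- 2); last by rewrite mulrNN mulrC mulNr.
by apply: cdiff_near; apply: (@filterE _ (nbhs z)) => w /=; rewrite mulNr.
Qed.

(** With [a] the conjugate of [z], this is the conjugate of the Szego kernel on the circle;
    conjugating an integral against that kernel leaves the mean of a product in the class. The
    derivative bound rests on |1 - a z| >= 1 - |z|. *)
Lemma hardy_kernel a : normc a < 1 ->
  hardy (fun z => (1 - a * z)^-1) (fun z => a * (1 - a * z) ^- 2)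
    (1 - normc a)^-1 1.
Proof.
move=> a1; have a0 : 0 < 1 - normc a by rewrite subr_gt0.
have lea z : normc z <= 1 -> normc (a * z) <= normc a.
  by move=> z1; rewrite normcM ler_piMr ?normc_ge0.
have lez z : normc (a * z) <= normc z.
  by rewrite normcM ler_piMl ?normc_ge0 // ltW.
have n0 z : normc z <= 1 -> 1 - a * z != 0.
  by move=> /lea h; apply: normc_subr1_gt0; exact: le_lt_trans a1.
have caff z : {for z, continuous (fun w => 1 - a * w)}.
  rewrite (_ : (fun w => 1 - a * w) = fun w => 1 + - a * w).
    exact: cdiff_continuous (cdiff_affine 1 (- a) z).
  by apply/funext => w; rewrite mulNr.
split.
- by move=> z z1; apply: cdiff_kernel; apply: n0; exact: ltW.
- move=> z z1; apply: continuous_cM; first exact: continuous_ccst.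
  apply: continuous_cV; last by rewrite expf_neq0 // n0 // ltW.
  exact: cvg_comp (caff z) (cdiff_continuous (cdiff_sqr _)).
- move=> z z1; rewrite normcV lef_pV2 ?posrE //; last by rewrite normc_gt0 n0 // ltW.
  apply: le_trans (normc1B_ge _); rewrite lerD2l lerN2; apply: lea; exact: ltW.
- move=> z z1; rewrite normcM normcV normcX -mulrA.
  have z0 : 0 < 1 - normc z by rewrite subr_gt0.
  have h : 1 - normc z <= normc (1 - a * z).
    by apply: le_trans (normc1B_ge _); rewrite lerD2l lerN2.
  apply: (@le_trans _ _ (1 * 1)); last by rewrite mulr1.
  apply: ler_pM; rewrite ?normc_ge0 //.
  - by apply: mulr_ge0; [rewrite invr_ge0 exprn_ge0 ?normc_ge0|exact: sqr_ge0].
  - exact: ltW.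
  - rewrite mulrC ler_pdivrMr ?exprn_gt0 ?(lt_le_trans z0) // mul1r.
    by rewrite ler_pXn2r ?nnegrE ?normc_ge0 // ltW.
- move=> z z1 _; apply: continuous_cV; first exact: caff.
  by apply: n0; rewrite z1.
Qed.

End HardyClass.

(** * Cauchy's formula by contraction of the circle *)

Section CauchyFormula.
Context {R : realType}.
Implicit Types (z w a : R[i]) (s x y t th : R) (f g h : R[i] -> R[i]) (u v : R -> R[i]).
Local Notation mu := (@lebesgue_measure R).

Lemma eq_vdiff u v t d : u =1 v -> vdiff u t d -> vdiff v t d.
Proof. by move=> /funext ->. Qed.

Lemma vdiff_affine (a b : R[i]) t : vdiff (fun s => a + s%:C * b) t b.
Proof.
move=> e e0; apply: (@filterE _ (nbhs t)) => s.
rewrite (_ : _ - _ = 0); last by rewrite rmorphB; ring.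
by rewrite normc0 mulr_ge0 // ltW.
Qed.

Lemma cexp_expi th : cexp (th%:C * 'i) = expi th.
Proof. by rewrite /cexp /= !mul0r mulr0 mulr1 subr0 addr0 expR0 mul1r. Qed.

Lemma vdiff_expi th : vdiff expi th ('i * expi th).
Proof.
have := vdiff_comp (vdiff_affine 0 'i%C th) (cdiff_cexp _).
rewrite (_ : cexp _ * _ = 'i * expi th); last by (cbv beta; rewrite add0r cexp_expi mulrC).
by apply: eq_vdiff => s /=; rewrite add0r cexp_expi.
Qed.

Lemma expi_conjV th : (expi th)^* = (expi th)^-1.
Proof.
apply: (@mulIf _ (expi th)).
  by rewrite -normc_gt0 normc_expi.
rewrite mulVf -?normc_gt0 ?normc_expi // mulrC.
by rewrite -expiN -expiD subrr expi0.
Qed.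

Lemma expi_neq1 th : 0 < th < 2 * pi -> expi th != 1.
Proof.
move=> /andP[t0 t2]; apply/negP => /eqP [c1 _].
have : 0 < sin (th / 2) by apply: sin_gt0_pi; apply/andP; split; lra.
have : cos th = 1 - 2 * sin (th / 2) ^+ 2.
  have -> : cos th = cos (th / 2 *+ 2) by congr cos; rewrite mulr2n -splitr.
  by rewrite cos_mulr2n cos2sin2; ring.
rewrite c1 => h sp; have : sin (th / 2) ^+ 2 > 0 by rewrite exprn_gt0.
lra.
Qed.

Section Cauchy.
Context (g h : R[i] -> R[i]) (B M : R) (z : R[i]).
Context (Hg : hardy g h B M) (z1 : normc z < 1).

(* The dilation of the unit circle about [z] contracts it to [z] inside the disc. *)
Let ga s th := z + s%:C * (expi th - z).
Let K th := (1 - z * expi (- th))^-1.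

Let z1' : 0 < 1 - normc z. Proof. by rewrite subr_gt0. Qed.

(** [ga s th] is a convex combination of [z] and a point of the circle. *)
Let ga_le s th : 0 < s < 1 -> (1 - s) * (1 - normc z) <= 1 - normc (ga s th).
Proof.
move=> /andP[s0 s1].
have -> : ga s th = (1 - s)%:C * z + s%:C * expi th.
  by rewrite /ga rmorphB; ring.
have := le_normcD ((1 - s)%:C * z) (s%:C * expi th).
rewrite !normcM !normc_real normc_expi mulr1 (ger0_norm (ltW s0)) ger0_norm ?subr_ge0 ?(ltW s1) //.
lra.
Qed.

Let ga_lt1 s th : 0 < s < 1 -> normc (ga s th) < 1.
Proof.
move=> s01; rewrite -subr_gt0; apply: lt_le_trans (ga_le th s01).
by rewrite mulr_gt0 // subr_gt0; case/andP: s01.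
Qed.

Let den_neq0 th : 1 - z * expi (- th) != 0.
Proof. by apply: normc_subr1_gt0; rewrite normcM normc_expi mulr1. Qed.

(** Since [expi th - z] is the derivative of [ga] in [s], the kernel makes the derivative of
    [g (ga s th) * K th] in [s] equal to [h (ga s th) * expi th], which is also the derivative in
    [th] of g (ga s th) / (s i). *)
Let kerE th : (expi th - z) * K th = expi th.
Proof.
have e0 : expi th != 0 by rewrite -normc_gt0 normc_expi.
have := den_neq0 th; rewrite /K expiN expi_conjV => d0.
apply: (@mulIf _ (1 - z / expi th)) => //.
by rewrite mulrVK ?unitfE //; field.
Qed.

Let K_le th : normc (K th) <= (1 - normc z)^-1.
Proof.
rewrite normcV lef_pV2 ?posrE // ?normc_gt0 //.
by apply: le_trans (normc1B_ge _); rewrite normcM normc_expi mulr1.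
Qed.

Let K_cont : continuous K.
Proof.
move=> th; apply: (continuous_cV (p := fun r => 1 - z * expi (- r)) _ (den_neq0 th)).
have cz : {for expi (- th), continuous (fun w => 1 + - z * w)}.
  exact: cdiff_continuous (cdiff_affine _ _ _).
rewrite (_ : (fun r => 1 - _) = fun r : R => 1 + - z * expi (- r)); last first.
  by apply/funext => r; rewrite mulNr.
have ce : {for th, continuous (fun r : R => expi (- r) : R[i])}.
  have co : (fun r : R => - r) r @[r --> th] --> - th by apply: cvgN; exact: cvg_id.
  exact: cvg_comp co (vdiff_continuous (vdiff_expi (- th))).
exact: cvg_comp ce cz.
Qed.

Let vdiff_s s th : 0 < s < 1 -> vdiff (fun s => g (ga s th) * K th) s (h (ga s th) * expi th).
Proof.
move=> s01.
have H1 := vdiff_comp (vdiff_affine z (expi th - z) s) (hardy_cdiff Hg (ga_lt1 th s01)).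
have H2 := cdiffZ (K th) (@cdiff_id R (g (ga s th))).
have := vdiff_comp H1 H2.
rewrite mulr1 (_ : K th * _ = h (ga s th) * expi th); last first.
  by rewrite -[in RHS]kerE; ring.
by apply: eq_vdiff => r /=; rewrite mulrC.
Qed.

Let vdiff_ga s th : vdiff (ga s) th (s%:C * ('i * expi th)).
Proof.
have := vdiff_comp (vdiff_expi th) (cdiff_affine (z - s%:C * z) s%:C (expi th)).
by apply: eq_vdiff => r /=; rewrite /ga; ring.
Qed.

Let vdiff_th s th : 0 < s < 1 ->
  vdiff (fun th => g (ga s th) / (s%:C * 'i)) th (h (ga s th) * expi th).
Proof.
move=> s01.
have H1 := vdiff_comp (vdiff_ga s th) (hardy_cdiff Hg (ga_lt1 th s01)).
have H2 := cdiffZ (s%:C * 'i)^-1 (@cdiff_id R (g (ga s th))).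
have := vdiff_comp H1 H2.
have s0 : s%:C != 0 :> R[i] by rewrite -normc_gt0 normc_real normr_gt0 gt_eqF; case/andP: s01.
have i0 : 'i%C != 0 :> R[i] by rewrite eq_complex /= oner_eq0 andbF.
rewrite mulr1 (_ : _ * (h _ * _) = h (ga s th) * expi th); last first.
  by rewrite (mulrA s%:C) mulrCA mulKf ?mulf_neq0.
by apply: eq_vdiff => r /=; rewrite mulrC.
Qed.

Let ga0 th : ga 0 th = z.
Proof. by rewrite /ga mul0r addr0. Qed.

Let ga1 th : ga 1 th = expi th.
Proof. by rewrite /ga mul1r addrC subrK. Qed.

Let ga_cvg0 th : ga s th @[s --> 0^'+] --> z.
Proof.
have := cvg_at_right_filter (vdiff_continuous (vdiff_affine z (expi th - z) 0)).
by rewrite -/(ga 0 th) ga0.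
Qed.

Let ga_cvg1 th : ga s th @[s --> 1^'-] --> expi th.
Proof.
have := cvg_at_left_filter (vdiff_continuous (vdiff_affine z (expi th - z) 1)).
by rewrite -/(ga 1 th) ga1.
Qed.

Let cvg_mulK (T : Type) (F : set_system T) (FF : Filter F) (p : T -> R[i]) w c :
  p r @[r --> F] --> w -> complex.Re (p r * c) @[r --> F] --> complex.Re (w * c).
Proof.
move=> pw; under eq_fun do rewrite cReM.
rewrite cReM; apply: cvgB; apply: cvgM; try exact: cvg_cst.
  exact: cvg_Re.
exact: cvg_Im.
Qed.

Lemma cauchy_Re :
  \int[mu]_(th in `]0, 2 * pi[) complex.Re (g z * K th) =
  \int[mu]_(th in `]0, 2 * pi[) complex.Re (g (expi th) * K th).
Proof.
apply: (@homotopy_Rintegral _ _ _ (B * (1 - normc z)^-1)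
  (fun s th => complex.Re (g (ga s th) * K th))
  (fun s th => complex.Re (h (ga s th) * expi th))
  (fun s th => complex.Re (g (ga s th) / (s%:C * 'i)))).
- by rewrite mulr_gt0 ?pi_gt0.
- by move=> s th s01; exact: vdiff_is_derive_Re (vdiff_s th s01).
- by move=> s th s01; exact: vdiff_is_derive_Re (vdiff_th th s01).
- move=> s s01; rewrite /ga; suff -> : expi (2 * pi) = expi 0 :> R[i] by [].
  by rewrite /expi mulr_natl cos2pi sin2pi cos0 sin0.
- move=> s s01 th; apply: cvg_Re; apply: continuous_cM; last exact: K_cont.
  exact: cvg_comp (vdiff_continuous (vdiff_ga s th))
    (cdiff_continuous (hardy_cdiff Hg (ga_lt1 th s01))).
- move=> s s01 th; apply: cvg_Re; apply: continuous_cM.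
    exact: cvg_comp (vdiff_continuous (vdiff_ga s th)) (hardy_cont Hg (ga_lt1 th s01)).
  exact: vdiff_continuous (vdiff_expi th).
- move=> s th s01; apply: le_trans (normRe_le _) _; rewrite normcM.
  by apply: ler_pM; rewrite ?normc_ge0 // (hardy_le Hg) // ga_lt1.
(* For [s < r] the contracted circle keeps a distance of at least (1 - r) (1 - |z|) from the unit
   circle, and [hardy_deriv_le] then bounds [h]. *)
- move=> r /andP[r0 r1]; have d0 : 0 < (1 - r) * (1 - normc z) by rewrite mulr_gt0 // subr_gt0.
  exists (M / ((1 - r) * (1 - normc z)) ^+ 2) => s th /andP[s0 sr].
  have s01 : 0 < s < 1 by rewrite s0 (lt_trans sr).
  apply: le_trans (normRe_le _) _; rewrite normcM normc_expi mulr1.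
  rewrite ler_pdivlMr ?exprn_gt0 //; apply: le_trans (hardy_deriv_le Hg (ga_lt1 th s01)).
  apply: ler_wpM2l; first exact: normc_ge0.
  have dle : (1 - r) * (1 - normc z) <= 1 - normc (ga s th).
    by apply: le_trans (ga_le th s01); rewrite ler_pM2r // lerD2l lerN2 ltW.
  by rewrite ler_pXn2r ?nnegrE ?(ltW d0) // (le_trans (ltW d0)).
- move=> th _; apply: cvg_mulK.
  have c := cdiff_continuous (hardy_cdiff Hg z1).
  exact: (cvg_comp _ _ (ga_cvg0 th) c).
(* The open interval of angles excludes the point 1, so [hardy_boundary] applies at each of them. *)
- move=> th; rewrite in_itv /= => th02; apply: cvg_mulK.
  have c := hardy_boundary Hg (normc_expi th) (expi_neq1 th02).
  exact: (cvg_comp _ _ (@ga_cvg1 th) c).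
Qed.

End Cauchy.
End CauchyFormula.

(** * Evaluation of the Szego projection *)

Section SzegoProjection.
Context {R : realType}.
Implicit Types (z w a c : R[i]) (s x y t th : R) (f g h : R[i] -> R[i]) (u v : R -> R[i]).
Local Notation mu := (@lebesgue_measure R).
Local Notation arc := `]0%R, 2 * pi[.
Local Notation cint := (@cintegral R [set` arc]).

(** The open arc leaves out the angles of the point 1, where boundary functions may be
    discontinuous; boundedness then gives integrability. *)
Definition bounded_continuous u :=
  (forall th, th \in arc -> {for th, continuous u}) /\
  exists B : R, forall th, th \in arc -> normc (u th) <= B.

Lemma bounded_continuous_integrable u : bounded_continuous u ->
  mu.-integrable [set` arc] (EFin \o (fun th => complex.Re (u th))) /\
  mu.-integrable [set` arc] (EFin \o (fun th => complex.Im (u th))).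
Proof.
move=> [cu [B uB]]; split; apply: (@integrable_continuous_oo _ _ _ B) => th Dth.
- exact: cvg_Re (cu _ Dth).
- by apply: le_trans (normRe_le _) (uB _ Dth).
- exact: cvg_Im (cu _ Dth).
- by apply: le_trans (normIm_le _) (uB _ Dth).
Qed.

Lemma bounded_continuousM u v : bounded_continuous u -> bounded_continuous v ->
  bounded_continuous (fun th => u th * v th).
Proof.
move=> [cu [B uB]] [cv [B' vB]]; split.
  by move=> th Dth; apply: continuous_cM; [exact: cu|exact: cv].
exists (B * B') => th Dth; rewrite normcM.
by apply: ler_pM; rewrite ?normc_ge0 // ?uB ?vB.
Qed.

Lemma bounded_continuousD u v : bounded_continuous u -> bounded_continuous v ->
  bounded_continuous (fun th => u th + v th).
Proof.
move=> [cu [B uB]] [cv [B' vB]]; split.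
  by move=> th Dth; apply: continuous_cD; [exact: cu|exact: cv].
exists (B + B') => th Dth; apply: le_trans (le_normcD _ _) _.
by apply: lerD; rewrite ?uB ?vB.
Qed.

Lemma bounded_continuous_cst c : bounded_continuous (fun=> c).
Proof.
split; first by move=> th _; exact: continuous_ccst.
by exists (normc c).
Qed.

Lemma cRe_conj z : complex.Re z^* = complex.Re z.
Proof. by case: z. Qed.

Lemma cIm_conj z : complex.Im z^* = - complex.Im z.
Proof. by case: z. Qed.

Lemma conjcM z w : (z * w)^* = z^* * w^*.
Proof. exact: (rmorphM conjc). Qed.

Lemma conjcB z w : (z - w)^* = z^* - w^*.
Proof. exact: (rmorphB conjc). Qed.

Lemma bounded_continuous_conj u : bounded_continuous u ->
  bounded_continuous (fun th => (u th)^*).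
Proof.
move=> [cu [B uB]]; split; last by exists B => th Dth; rewrite normc_conj uB.
move=> th Dth; have := cu _ Dth => {}cu; apply: cvg_ReIm.
  by under eq_fun do rewrite cRe_conj; rewrite cRe_conj; exact: cvg_Re.
by under eq_fun do rewrite cIm_conj; rewrite cIm_conj; apply: cvgN; exact: cvg_Im.
Qed.

Lemma cintegralD u v : bounded_continuous u -> bounded_continuous v ->
  cint (fun th => u th + v th) = cint u + cint v.
Proof.
move=> /bounded_continuous_integrable[uR uI] /bounded_continuous_integrable[vR vI].
rewrite /cintegral; apply/eqP; rewrite eq_complex /= -!RintegralD //.
by apply/andP; split; apply/eqP; apply: eq_Rintegral => th _; rewrite ?cReD ?cImD.
Qed.

Lemma cintegralZ c u : bounded_continuous u ->
  cint (fun th => c * u th) = c * cint u.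
Proof.
move=> /bounded_continuous_integrable[uR uI].
have mD : measurable ([set` arc] : set (measurableTypeR R)) by exact: measurable_itv.
have intZ x (f : R -> R) : mu.-integrable [set` arc] (EFin \o f) ->
    mu.-integrable [set` arc] (EFin \o (fun th => x * f th)).
  by move=> intf; have := integrableZl mD x intf.
rewrite /cintegral; apply/eqP; rewrite eq_complex cReM cImM /=.
apply/andP; split; apply/eqP.
  rewrite -!RintegralZl // -RintegralB //; [|exact: intZ|exact: intZ].
  by apply: eq_Rintegral => th _; rewrite cReM.
rewrite -!RintegralZl // -RintegralD //; [|exact: intZ|exact: intZ].
by apply: eq_Rintegral => th _; rewrite cImM.
Qed.

Lemma cintegral_conj u : bounded_continuous u ->
  cint (fun th => (u th)^*) = (cint u)^*.
Proof.
move=> /bounded_continuous_integrable[uR uI].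
have mD : measurable ([set` arc] : set (measurableTypeR R)) by exact: measurable_itv.
rewrite /cintegral; apply/eqP; rewrite eq_complex cRe_conj cIm_conj /=.
apply/andP; split; apply/eqP.
  by apply: eq_Rintegral => th _; rewrite cRe_conj.
rewrite -mulN1r -RintegralZl //.
by apply: eq_Rintegral => th _; rewrite cIm_conj mulN1r.
Qed.

Lemma eq_cintegral u v : (forall th, th \in arc -> u th = v th) -> cint u = cint v.
Proof.
move=> uv; rewrite /cintegral; congr (_ +i* _); apply: eq_Rintegral => th;
  by rewrite inE /= => Dth; rewrite uv.
Qed.

Lemma cintegral1 : cint (fun=> 1) = (2 * pi)%:C.
Proof.
rewrite /cintegral /= !Rintegral_cst; try exact: measurable_itv.
rewrite /= lebesgue_measure_itv /= lte_fin mulr_gt0 ?pi_gt0 //= subr0 mul0r.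
by rewrite mul1r.
Qed.

Lemma cintegral_cc u : bounded_continuous u ->
  cintegral `[0, 2 * pi]%classic u = cint u.
Proof.
move=> /bounded_continuous_integrable[uR uI].
rewrite /cintegral /Rintegral; congr (fine _ +i* fine _); rewrite integral_itv_bndoo //.
  exact: measurable_int uR.
exact: measurable_int uI.
Qed.

(** [szego_ext] integrates over the closed interval, whose end points are angles of 1, where nothing
    is known of [u]; they form a null set. *)
Lemma eq_cintegral_cc u v : bounded_continuous v ->
  (forall th, th \in arc -> u th = v th) -> cintegral `[0, 2 * pi]%classic u = cint v.
Proof.
move=> bv uv; rewrite -(cintegral_cc bv).
have [mR mI] := bounded_continuous_integrable bv.
have mvR : measurable_fun [set` arc] (fun th => complex.Re (v th)).
  by apply/measurable_EFinP; exact: measurable_int mR.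
have mvI : measurable_fun [set` arc] (fun th => complex.Im (v th)).
  by apply/measurable_EFinP; exact: measurable_int mI.
rewrite /cintegral /Rintegral; congr (fine _ +i* fine _);
  apply: eq_integral_itv_bounded => //.
- by apply: eq_measurable_fun mvR => th; rewrite inE /= => Dth; rewrite uv.
- by move=> th Dth; rewrite uv.
- by apply: eq_measurable_fun mvI => th; rewrite inE /= => Dth; rewrite uv.
- by move=> th Dth; rewrite uv.
Qed.

Lemma hardy_boundary_le g h B M z : hardy g h B M -> normc z = 1 -> z != 1 ->
  normc (g z) <= B.
Proof.
move=> Hg z1 zn1; have c := hardy_boundary Hg z1 zn1.
rewrite leNgt; apply/negP => Bg.
have e0 : 0 < normc (g z) - B by rewrite subr_gt0.
have : \forall w \near z, normc (g z - g w) < normc (g z) - B.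
  by move/cvg_complexP : c; exact.
move=> /near_complexP[e e1 he].
(* A radial step inwards: [e / 2] keeps the point in the neighbourhood, and [2^-1] keeps [1 - d]
   positive. *)
pose d := Num.min (e / 2) (2^-1).
have d0 : 0 < d by rewrite lt_min divr_gt0 //= invr_gt0.
have de : d < e.
  apply: (@le_lt_trans _ _ (e / 2)); first by rewrite ge_min lexx.
  by rewrite ltr_pdivrMr // ltr_pMr // ltr1n.
have d1 : d < 1.
  by apply: (@le_lt_trans _ _ (2^-1)); [rewrite ge_min lexx orbT|rewrite invf_lt1 // ltr1n].
have := he ((1 - d)%:C * z).
have -> : z - (1 - d)%:C * z = d%:C * z by rewrite rmorphB; ring.
rewrite normcM normc_real z1 mulr1 (gtr0_norm d0) => /(_ de) H.
have lt1 : normc ((1 - d)%:C * z) < 1.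
  by rewrite normcM normc_real z1 mulr1 gtr0_norm ?subr_gt0 // ltrBlDr ltrDl.
have := hardy_le Hg lt1.
by have := ler_normcB (g z) (g z - g ((1 - d)%:C * z)); rewrite opprB addrCA subrr addr0; lra.
Qed.

Definition szego_kernel z th : R[i] := (1 - z * expi (- th))^-1.

Lemma hardy_bounded_continuous g h B M : hardy g h B M ->
  bounded_continuous (fun th => g (expi th)).
Proof.
move=> Hg; split=> [th|].
  rewrite in_itv /= => /expi_neq1 Dth.
  have c := hardy_boundary Hg (normc_expi th) Dth.
  exact: (cvg_comp _ _ (vdiff_continuous (@vdiff_expi _ th)) c).
exists B => th; rewrite in_itv /= => /expi_neq1 Dth.
by apply: hardy_boundary_le Hg _ Dth; exact: normc_expi.
Qed.

Lemma szego_kernel_conj z th : (szego_kernel z th)^* = (1 - z^* * expi th)^-1.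
Proof.
by rewrite /szego_kernel conjc_inv expiN conjcB conjcM conjc1 conjcK.
Qed.

Lemma szego_kernelE z th : szego_kernel z th = ((1 - z^* * expi th)^-1)^*.
Proof. by rewrite -szego_kernel_conj conjcK. Qed.

Lemma bounded_continuous_kernel z : normc z < 1 -> bounded_continuous (szego_kernel z).
Proof.
move=> z1; have -> : szego_kernel z = fun th => ((1 - z^* * expi th)^-1)^*.
  by apply/funext => th; exact: szego_kernelE.
apply: bounded_continuous_conj; apply: hardy_bounded_continuous (hardy_kernel _).
by rewrite normc_conj.
Qed.

(** Real parts come from [cauchy_Re] for [g], imaginary parts from [cauchy_Re] for - i g. The
    integral of the kernel stays unevaluated here: its value is deduced below from the case [z = 0],
    where the kernel is 1. *)
Lemma cauchy_formula g h B M z : hardy g h B M -> normc z < 1 ->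
  cint (fun th => g (expi th) * szego_kernel z th) = g z * cint (szego_kernel z).
Proof.
move=> Hg z1; rewrite -cintegralZ; last exact: bounded_continuous_kernel.
have HI := hardyZ (- 'i) Hg.
rewrite /cintegral; congr (_ +i* _); first by apply/esym; exact: cauchy_Re Hg z1.
have ImE w : complex.Im w = complex.Re (- 'i * w).
  by case: w => a b /=; rewrite !oppr0 mul0r mulN1r opprK add0r.
transitivity (\int[mu]_(th in [set` arc]) complex.Re (- 'i * g (expi th) * szego_kernel z th)).
  by apply: eq_Rintegral => th _; rewrite ImE mulrA.
rewrite -(cauchy_Re HI z1).
by apply: eq_Rintegral => th _; rewrite ImE mulrA.
Qed.

Lemma szego_kernel0 th : szego_kernel 0 th = 1.
Proof. by rewrite /szego_kernel mul0r subr0 invr1. Qed.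

Lemma mean_value g h B M : hardy g h B M ->
  cint (fun th => g (expi th)) = g 0 * (2 * pi)%:C.
Proof.
move=> Hg; have n0 : normc (0 : R[i]) < 1 by rewrite normc0.
rewrite -cintegral1; have := cauchy_formula Hg n0.
rewrite (@eq_cintegral _ (fun th => g (expi th))); last by move=> th _; rewrite szego_kernel0 mulr1.
by rewrite (@eq_cintegral (szego_kernel 0) (fun=> 1)) // => th _; rewrite szego_kernel0.
Qed.

(** Conjugation turns the integrand into the product of [g] with an analytic kernel equal to 1 at 0,
    so the mean value property applies: a conjugate of an analytic function projects to a
    constant. *)
Lemma cintegral_conj_kernel g h B M z : hardy g h B M -> normc z < 1 ->
  cint (fun th => (g (expi th))^* * szego_kernel z th) = (g 0)^* * (2 * pi)%:C.
Proof.
move=> Hg z1; have z1' : normc z^* < 1 by rewrite normc_conj.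
have Hp := hardyM Hg (hardy_kernel z1').
rewrite -(conjcK (cint _)) -cintegral_conj; last first.
  apply: bounded_continuousM (bounded_continuous_kernel z1).
  exact: bounded_continuous_conj (hardy_bounded_continuous Hg).
rewrite (@eq_cintegral _ (fun th => g (expi th) * (1 - z^* * expi th)^-1)); last first.
  by move=> th _; rewrite conjcM conjcK szego_kernel_conj.
rewrite (mean_value Hp) mulr0 subr0 invr1 mulr1 conjcM; congr (_ * _).
by rewrite /= oppr0.
Qed.

Lemma cintegral_kernel z : normc z < 1 -> cint (szego_kernel z) = (2 * pi)%:C.
Proof.
move=> z1; have := cintegral_conj_kernel (@hardy_cst _ 1) z1.
rewrite conjc1 mul1r => <-; apply: eq_cintegral => th _.
by rewrite mul1r.
Qed.

Lemma szego_ext_conjB g h B M u z : hardy g h B M -> normc z < 1 ->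
  (forall th, th \in arc -> u th = (g (expi th))^* - g (expi th)) ->
  szego_ext u z = (g 0)^* - g z.
Proof.
move=> Hg z1 uE.
have bk := bounded_continuous_kernel z1.
have bg := hardy_bounded_continuous Hg.
have b1 := bounded_continuousM (bounded_continuous_conj bg) bk.
have b2 := bounded_continuousM (bounded_continuous_cst (-1)) (bounded_continuousM bg bk).
rewrite /szego_ext (eq_cintegral_cc (bounded_continuousD b1 b2)); last first.
  by move=> th Dth; rewrite uE // mulrBl mulN1r.
rewrite cintegralD // (cintegral_conj_kernel Hg z1) cintegralZ; last exact: bounded_continuousM.
rewrite (cauchy_formula Hg z1) (cintegral_kernel z1) mulN1r -mulrBl.
rewrite mulrCA -rmorphM /= mulVf ?mulr1 //.
by rewrite gt_eqF // mulr_gt0 ?pi_gt0.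
Qed.

End SzegoProjection.

(** * Powers of the atomic inner function *)

Section AtomicFamily.
Context {R : realType}.
Implicit Types (z w : R[i]) (c d x y t th : R).

(* [Spow c] is the [c]-th power of the atomic inner function. *)
Definition Spow c z : R[i] := cexp (c%:C * ((z + 1) / (z - 1))).

(** (z + 1) / (z - 1) is 1 + 2 / (z - 1), whence the last factor. *)
Definition dSpow c z : R[i] := Spow c z * (c%:C * (- 2 * (z - 1) ^- 2)).

Lemma atomic_innerE : @atomic_inner R = Spow 1.
Proof. by apply/funext => z; rewrite /Spow mul1r. Qed.

Lemma cRe_cayley z :
  complex.Re ((z + 1) / (z - 1)) = (normc z ^+ 2 - 1) / normc (z - 1) ^+ 2.
Proof.
rewrite !sqr_normcE; case: z => a b /=.
by rewrite !subr0 !addr0; ring.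
Qed.

Lemma normc_Spow c z :
  normc (Spow c z) = expR (c * ((normc z ^+ 2 - 1) / normc (z - 1) ^+ 2)).
Proof. by rewrite normc_cexp cReMr cRe_cayley. Qed.

Lemma normc_Spow_le1 c z : 0 <= c -> normc z <= 1 -> normc (Spow c z) <= 1.
Proof.
move=> c0 z1; rewrite normc_Spow -[leRHS]expR0 ler_expR.
rewrite mulr_ge0_le0 // mulr_le0_ge0 ?invr_ge0 ?sqr_ge0 //.
by rewrite subr_le0 expr_le1 // normc_ge0.
Qed.

(** The exponent is purely imaginary on the circle. At the point 1, division by 0 yields 0, so that
    [Spow c 1] is 1. *)
Lemma normc_Spow_circle c z : normc z = 1 -> normc (Spow c z) = 1.
Proof. by move=> z1; rewrite normc_Spow z1 expr1n subrr mul0r mulr0 expR0. Qed.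

Lemma SpowD c d z : Spow (c + d) z = Spow c z * Spow d z.
Proof. by rewrite /Spow -cexpD -mulrDl -rmorphD. Qed.

Lemma Spow0 z : Spow 0 z = 1.
Proof. by rewrite /Spow mul0r cexp0. Qed.

Lemma SpowMn c n z : Spow (c *+ n) z = Spow c z ^+ n.
Proof.
elim: n => [|n IH]; first by rewrite mulr0n Spow0 expr0.
by rewrite mulrS exprS SpowD IH.
Qed.

Lemma Spow_at0 c : Spow c 0 = (expR (- c))%:C.
Proof.
rewrite /Spow add0r sub0r invrN1 mulrN1 mulrN1 /cexp -rmorphN /= expi0.
by rewrite mulr1.
Qed.

Lemma cdiff_Spow c z : z != 1 -> cdiff (Spow c) z (dSpow c z).
Proof.
move=> zn1; have z0 : -1 + 1 * z != 0 by rewrite mul1r addrC subr_eq0.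
have := cdiff_comp (cdiff_comp (cdiff_affine (-1) 1 z) (cdiff_inv z0))
  (cdiff_affine c%:C (c%:C * 2) _).
move=> /cdiff_comp /(_ (cdiff_cexp _)).
rewrite (_ : cexp _ * _ = dSpow c z); last first.
  rewrite /dSpow /Spow /= mul1r; congr (cexp _ * _).
    by field; rewrite subr_eq0.
  by field; rewrite subr_eq0.
apply: cdiff_near; apply: filterS (near_neq zn1) => w wn1 /=.
rewrite /Spow; congr cexp; field.
by rewrite subr_eq0 wn1.
Qed.

Lemma continuous_dSpow c z : z != 1 -> {for z, continuous (dSpow c)}.
Proof.
move=> zn1; apply: continuous_cM; first exact: cdiff_continuous (cdiff_Spow c zn1).
apply: continuous_cM; first exact: continuous_ccst.
apply: continuous_cM; first exact: continuous_ccst.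
apply: continuous_cV; last by rewrite expf_neq0 // subr_eq0.
have a : {for z, continuous (fun w => w - 1)}.
  rewrite (_ : (fun w => w - 1) = fun w => -1 + 1 * w).
    exact: cdiff_continuous (cdiff_affine _ _ _).
  by apply/funext => w; rewrite mul1r addrC.
exact: cvg_comp a (cdiff_continuous (cdiff_sqr _)).
Qed.

Lemma normc_lt1_neq1 z : normc z < 1 -> z != 1.
Proof. by apply: contraTneq => ->; rewrite normc1 ltxx. Qed.

(** As |z - 1| >= 1 - |z|, the weight (1 - |z|)^2 absorbs the factor (z - 1)^-2 of the
    derivative. *)
Lemma hardy_Spow c : 0 <= c -> hardy (Spow c) (dSpow c) 1 (c * 2).
Proof.
move=> c0; split.
- by move=> z /normc_lt1_neq1; exact: cdiff_Spow.
- by move=> z /normc_lt1_neq1; exact: continuous_dSpow.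
- by move=> z z1; apply: normc_Spow_le1; rewrite // ltW.
- move=> z z1; rewrite normcM -mulrA -[leRHS]mul1r; apply: ler_pM.
  + exact: normc_ge0.
  + by rewrite mulr_ge0 ?normc_ge0 ?sqr_ge0.
  + by apply: normc_Spow_le1; rewrite // ltW.
  rewrite normcM normc_real (ger0_norm c0) -mulrA; apply: ler_wpM2l => //.
  rewrite normcM normcN (_ : normc 2 = 2); last first.
    by rewrite -[2 in LHS](rmorph_nat (real_complex R)) normc_real ger0_norm.
  rewrite -mulrA -[leRHS]mulr1; apply: ler_wpM2l => //.
  rewrite normcV normcX mulrC ler_pdivrMr ?exprn_gt0 ?normc_gt0 ?subr_eq0 ?normc_lt1_neq1 //.
  rewrite mul1r ler_pXn2r ?nnegrE ?normc_ge0 ?subr_ge0 ?(ltW z1) //.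
  by rewrite normcB; exact: normc1B_ge.
- by move=> z z1 zn1; exact: cdiff_continuous (cdiff_Spow c zn1).
Qed.

End AtomicFamily.

(** * Fejer polynomials *)

Section FejerPolynomials.
Context {R : realType}.
Implicit Types (q z w : R[i]) (x y S : R) (k m n N p : nat).

Lemma abel_summation (a : nat -> R) (d : nat -> R[i]) m n :
  (m <= n)%N ->
  \sum_(m <= k < n) (a k)%:C * d k =
  \sum_(m <= k < n) (a k - a k.+1)%:C * (\sum_(m <= i < k.+1) d i)
    + (a n)%:C * \sum_(m <= i < n) d i.
Proof.
elim: n => [|n IH] mn.
  by move: mn; rewrite leqn0 => /eqP ->; rewrite !big_geq // mulr0 addr0.
move: mn; rewrite leq_eqVlt => /predU1P[->|mn].
  by rewrite !big_geq // mulr0 addr0.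
rewrite big_nat_recr //= [in RHS]big_nat_recr //= IH //.
rewrite [\sum_(m <= i < n.+1) d i]big_nat_recr //= rmorphB.
by ring.
Qed.

(** Dirichlet's test: the weights [a k - a k.+1] are nonnegative and telescope, together with [a n],
    to [a m]. *)
Lemma abel_bound (a : nat -> R) (d : nat -> R[i]) m n S :
  (forall k, (m <= k < n)%N -> a k.+1 <= a k) -> 0 <= a n -> (m <= n)%N ->
  (forall j, (m <= j <= n)%N -> normc (\sum_(m <= i < j) d i) <= S) ->
  normc (\sum_(m <= k < n) (a k)%:C * d k) <= S * a m.
Proof.
move=> da an mn dS; rewrite abel_summation //.
apply: le_trans (le_normcD _ _) _; rewrite normcM normc_real (ger0_norm an).
have -> : S * a m = \sum_(m <= k < n) (a k - a k.+1) * S + a n * S.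
  rewrite -mulr_suml -[X in X * S + _]opprK -sumrN.
  by rewrite (eq_bigr (fun k => a k.+1 - a k)) ?telescope_sumr // => [|k _]; ring.
apply: lerD; last by apply: ler_wpM2l => //; apply: dS; rewrite mn leqnn.
apply: le_trans (normc_sum _ _ _) _.
rewrite big_nat [leRHS]big_nat; apply: ler_sum => k kmn.
rewrite normcM normc_real ger0_norm ?subr_ge0 ?da //.
apply: ler_wpM2l; first by rewrite subr_ge0 da.
by apply: dS; move: kmn => /andP[mk kn]; rewrite (leq_trans mk) //=.
Qed.

(** [e] is a discrete primitive of [(1 - q) * d], so the sums telescope; this form covers both
    ascending and descending powers of [q]. *)
Lemma geometric_bound q (d : nat -> R[i]) (e : nat -> R[i]) m n :
  q != 1 -> (forall k, normc (e k) <= 1) ->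
  (forall k, (m <= k < n)%N -> (1 - q) * d k = e k.+1 - e k) ->
  forall j, (m <= j <= n)%N -> normc (\sum_(m <= i < j) d i) <= 2 / normc (1 - q).
Proof.
move=> q1 e1 de j /andP[mj jn].
have q0 : 0 < normc (1 - q) by rewrite normc_gt0 subr_eq0 eq_sym.
rewrite ler_pdivlMr // mulrC -normcM mulr_sumr.
rewrite (_ : \sum_(_ <= _ < _) _ = e j - e m); last first.
  rewrite big_nat -telescope_sumr // [in RHS]big_nat; apply: eq_bigr => k /andP[mk kj].
  by rewrite de // mk (leq_trans kj).
apply: le_trans (le_normcD _ _) _; rewrite normcN.
by rewrite (_ : 2 = 1 + 1) // lerD.
Qed.

Lemma inv_nat_decr k : (0 < k)%N -> (k.+1%:R^-1 : R) <= k%:R^-1.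
Proof. by move=> k0; rewrite lef_pV2 ?posrE ?ltr0n // ler_nat. Qed.

Lemma normcX_le1 q k : normc q <= 1 -> normc (q ^+ k) <= 1.
Proof. by move=> q1; rewrite normcX exprn_ile1 ?normc_ge0. Qed.

Lemma log_partial_sum_le q n : normc q <= 1 -> q != 1 ->
  normc (\sum_(1 <= k < n.+1) (k%:R^-1)%:C * q ^+ k) <= 2 / normc (1 - q).
Proof.
move=> q1 qn1; rewrite -[leRHS]mulr1 -[X in _ * X]invr1.
apply: (@abel_bound (fun k => k%:R^-1)) => //.
- by move=> k /andP[k0 _]; exact: inv_nat_decr.
- apply: (geometric_bound (e := fun k => - q ^+ k)) => // k.
    by rewrite normcN normcX_le1.
  by move=> _; rewrite exprS; ring.
Qed.

Lemma onesubX_le q k : normc q <= 1 -> normc (1 - q ^+ k) <= k%:R * normc (1 - q).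
Proof.
move=> q1; elim: k => [|k IH]; first by rewrite expr0 subrr normc0 mul0r.
have -> : 1 - q ^+ k.+1 = (1 - q) + q * (1 - q ^+ k) by rewrite exprS; ring.
apply: le_trans (le_normcD _ _) _; rewrite normcM.
rewrite -natr1 mulrDl mul1r addrC lerD2r.
by apply: le_trans IH; rewrite ler_piMl ?normc_ge0.
Qed.

(** For q = exp (i t) this is - 2 i q^n times the sum of sin (k t) / k: bounded sine sums, moved to
    positive degrees so as to be analytic in [q]. *)
Definition fejer n q : R[i] :=
  \sum_(1 <= k < n) (k%:R^-1)%:C * (q ^+ (n - k) - q ^+ (n + k)).

(* Cut at [k ~ 1 / |1 - q|]: below, [|1 - q ^ (2k)| <= 2k |1 - q|]; above, both geometric
   sums have partial sums at most [2 / |1 - q|] and Abel summation applies. *)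
Lemma fejer_le n q : normc q <= 1 -> normc (fejer n q) <= 6.
Proof.
move=> q1; have [->|qn1] := eqVneq q 1.
  rewrite /fejer big1 ?normc0 // => k _.
  by rewrite !expr1n subrr mulr0.
have d0 : 0 < normc (1 - q) by rewrite normc_gt0 subr_eq0 eq_sym.
case: n => [|n]; first by rewrite /fejer big_geq // normc0.
pose m := Num.Def.truncn (normc (1 - q))^-1.
have /andP[m1 m2] : m%:R <= (normc (1 - q))^-1 < m.+1%:R.
  by apply: truncn_itv; rewrite invr_ge0 ltW.
pose p := minn m.+1 n.+1.
have p0 : (0 < p)%N by rewrite /p; case: (leqP m.+1 n.+1).
have pn : (p <= n.+1)%N by rewrite geq_minr.
rewrite /fejer (@big_cat_nat _ _ _ p) //=.
(* The low part has at most [m] terms, and [m] is at most 1 / |1 - q|: it gives 2. In the high part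
   the first weight 1 / (m + 1) is below |1 - q|, so each of the two geometric sums gives 2. *)
apply: le_trans (le_normcD _ _) _; rewrite (_ : 6 = 2 + 4); last by ring.
apply: lerD.
  apply: le_trans (normc_sum _ _ _) _.
  apply: (@le_trans _ _ (\sum_(1 <= k < p) 2 * normc (1 - q))).
    rewrite big_nat [leRHS]big_nat; apply: ler_sum => k /andP[k0 kp].
    have kn : (k <= n.+1)%N by rewrite (leq_trans _ pn) // ltnW.
    have -> : q ^+ (n.+1 - k) - q ^+ (n.+1 + k) = q ^+ (n.+1 - k) * (1 - q ^+ (k + k)).
      by rewrite mulrBr mulr1 -exprD addnA subnK.
    have k0' : (0 : R) < k%:R by rewrite ltr0n.
    rewrite normcM normc_real ger0_norm ?invr_ge0 ?(ltW k0') // mulrC ler_pdivrMr //.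
    rewrite normcM; apply: (@le_trans _ _ (1 * normc (1 - q ^+ (k + k)))).
      by apply: ler_wpM2r; [exact: normc_ge0|exact: normcX_le1].
    rewrite mul1r; apply: le_trans (onesubX_le _ q1) _.
    by rewrite natrD le_eqVlt; apply/orP; left; apply/eqP; ring.
  rewrite sumr_const_nat -[leLHS]mulr_natr -mulrA -[leRHS]mulr1; apply: ler_wpM2l => //.
  rewrite mulrC -ler_pdivlMr // mul1r; apply: le_trans m1.
  by rewrite ler_nat subn1 -ltnS prednK // geq_minl.
have [mn|nm] := leqP m.+1 n.+1; last first.
  by rewrite big_geq ?normc0 // /p (minn_idPr (ltnW nm)).
have pE : p = m.+1 by rewrite /p (minn_idPl mn).
have half (d : nat -> R[i]) :
    (forall j, (p <= j <= n.+1)%N -> normc (\sum_(p <= i < j) d i) <= 2 / normc (1 - q)) ->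
    normc (\sum_(p <= k < n.+1) (k%:R^-1)%:C * d k) <= 2.
  move=> dS; apply: (le_trans (@abel_bound (fun k => k%:R^-1) d p n.+1 _ _ _ pn dS)).
  - by move=> k /andP[pk _]; apply: inv_nat_decr; exact: leq_trans pk.
  - by rewrite invr_ge0 ler0n.
  rewrite -mulrA -[leRHS]mulr1 pE; apply: ler_wpM2l => //.
  by rewrite ler_pdivrMr ?ltr0n // mul1r ltW.
rewrite (eq_bigr (fun k => (k%:R^-1)%:C * q ^+ (n.+1 - k)
    + - ((k%:R^-1)%:C * q ^+ (n.+1 + k)))); last first.
  by move=> k _; rewrite mulrBr.
rewrite big_split /= sumrN; apply: le_trans (le_normcD _ _) _.
rewrite normcN (_ : 4 = 2 + 2); last by ring.
apply: lerD; apply: half.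
  apply: (geometric_bound (e := fun k => q ^+ (n.+2 - k))) => // [k|k /andP[_ kn]].
    exact: normcX_le1.
  by rewrite subSS (@subSn k n.+1) ?(ltnW kn) // exprS; ring.
apply: (geometric_bound (e := fun k => - q ^+ (n.+1 + k))) => // [k|k _].
  by rewrite normcN normcX_le1.
by rewrite addnS exprS; ring.
Qed.

Lemma harmonic_sum_unbounded x : exists n, x < \sum_(1 <= k < n.+1) (k%:R^-1 : R).
Proof.
have : series (@harmonic R) n @[n --> \oo] --> +oo%R.
  apply: nondecreasing_dvgn_lt; last exact: dvg_harmonic.
  apply/nondecreasing_seqP => n.
  by rewrite !seriesEnat /= [leRHS]big_nat_recr //= lerDl harmonic_ge0.
move/cvgryPgt => /(_ x)[n _ /(_ n (leqnn n))] H.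
exists n; apply: lt_le_trans H _.
by rewrite seriesEnat /= big_add1.
Qed.

End FejerPolynomials.

(** * Unboundedness of the Hankel operator *)

Section HankelBlowup.
Context {R : realType}.
Implicit Types (q z w : R[i]) (c x y t th : R) (k n : nat) (f g h : R[i] -> R[i]) (u v : R -> R[i]).
Local Notation arc := `]0%R, 2 * pi[.

Lemma radial_cvg th : t%:C * expi th @[t --> 1^'-] --> (expi th : R[i]).
Proof.
have := cvg_at_left_filter (vdiff_continuous (vdiff_affine 0 (expi th : R[i]) 1)).
rewrite add0r mul1r; under eq_fun do rewrite add0r.
by [].
Qed.

Lemma boundary_lim f th l :
  f (t%:C * expi th) @[t --> 1^'-] --> l -> boundary f th = l.
Proof. by move=> fl; apply/cvg_lim. Qed.

Lemma hardy_boundaryE g h B M th : hardy g h B M -> th \in arc ->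
  boundary g th = g (expi th).
Proof.
move=> Hg; rewrite in_itv /= => /expi_neq1 Dth.
have c := hardy_boundary Hg (normc_expi th) Dth.
by apply: boundary_lim; exact: (cvg_comp _ _ (@radial_cvg th) c).
Qed.

Lemma szego_conjB g h B M u th : hardy g h B M -> th \in arc ->
  (forall s, s \in arc -> u s = (g (expi s))^* - g (expi s)) ->
  szego u th = (g 0)^* - g (expi th).
Proof.
move=> Hg Dth uE; apply: boundary_lim.
have Dth' : expi th != 1 :> R[i] by apply: expi_neq1; move: Dth; rewrite in_itv.
have c := hardy_boundary Hg (normc_expi th) Dth'.
have L : (g 0)^* + - 1 * g (t%:C * expi th) @[t --> 1^'-] --> (g 0)^* - g (expi th).
  have a := cdiff_continuous (cdiff_affine (g 0)^* (-1) (g (expi th))).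
  have := cvg_comp _ _ (cvg_comp _ _ (@radial_cvg th) c) a.
  by rewrite /= mulN1r.
apply: cvg_trans L; apply: near_eq_cvg; near=> t.
have t0 : 0 <= t by near: t; exact: nbhs_left_ge.
have t1 : t < 1 by near: t; exact: nbhs_left_lt.
rewrite mulN1r (szego_ext_conjB Hg _ uE) //.
by rewrite normcM normc_real normc_expi mulr1 ger0_norm.
Unshelve. all: by end_near. Qed.

Definition test_fun n z : R[i] := fejer n (Spow n%:R^-1 z).

(** A truncation of - log (1 - q): it grows with [n] near q = 1 and stays bounded away from
    there. *)
Definition log_sum n z : R[i] :=
  \sum_(1 <= k < n) (k%:R^-1)%:C * Spow n%:R^-1 z ^+ k.

Lemma eq_hardy g f : g =1 f ->
  (exists h B M, hardy g h B M) -> exists h B M, hardy f h B M.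
Proof. by move=> /funext ->. Qed.

Lemma hardy_SpowX c k : 0 <= c -> hardy (fun z => Spow c z ^+ k) (dSpow (c *+ k)) 1 (c *+ k * 2).
Proof.
move=> c0; rewrite (_ : (fun z => _) = Spow (c *+ k)).
  by apply: hardy_Spow; rewrite mulrn_wge0.
by apply/funext => z; rewrite SpowMn.
Qed.

Lemma hardy_test_fun n : exists h B M, hardy (test_fun n) h B M.
Proof.
have n0 : 0 <= n%:R^-1 :> R by rewrite invr_ge0.
apply: (hardy_sum _ (g := fun k z => (k%:R^-1)%:C *
  (Spow n%:R^-1 z ^+ (n - k) - Spow n%:R^-1 z ^+ (n + k)))) => k.
have H := hardyZ (k%:R^-1)%:C
  (hardyD (hardy_SpowX (n - k) n0) (hardyZ (-1) (hardy_SpowX (n + k) n0))).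
have H' : exists h B M, hardy (fun z => (k%:R^-1)%:C *
    (Spow n%:R^-1 z ^+ (n - k) + -1 * Spow n%:R^-1 z ^+ (n + k))) h B M.
  by eexists; eexists; eexists; exact: H.
apply: eq_hardy H' => z.
by rewrite mulN1r.
Qed.

Lemma hardy_log_sum n : exists h B M, hardy (log_sum n) h B M.
Proof.
have n0 : 0 <= n%:R^-1 :> R by rewrite invr_ge0.
apply: (hardy_sum _ (g := fun k z => (k%:R^-1)%:C * Spow n%:R^-1 z ^+ k)) => k.
by eexists; eexists; eexists; exact: hardyZ (hardy_SpowX k n0).
Qed.

Lemma hardy_Hinf_norm g h B M (C : R) : hardy g h B M ->
  (forall z, normc z < 1 -> normc (g z) <= C) -> (Hinf_norm g <= C%:E)%E.
Proof.
move=> Hg gC; apply: ge_ereal_sup => _ [z /disc_normc z1 <-]; rewrite lee_fin.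
exact: gC.
Qed.

Lemma hardy_analytic g h B M : hardy g h B M -> analytic_disc g.
Proof. by move=> Hg z /disc_normc z1; exact: cdiff_derivable (hardy_cdiff Hg z1). Qed.

Lemma hardy_Hinf g h B M : hardy g h B M -> Hinf g.
Proof.
move=> Hg; split; first exact: hardy_analytic Hg.
by apply: le_lt_trans (hardy_Hinf_norm Hg (hardy_le Hg)) _; rewrite ltry.
Qed.

Lemma Spow_atomic n z : (0 < n)%N -> atomic_inner z = Spow n%:R^-1 z ^+ n :> R[i].
Proof.
move=> n0; have e : n%:R^-1 *+ n = 1 :> R by rewrite -[LHS]mulr_natr mulVf // pnatr_eq0 -lt0n.
by rewrite -SpowMn e atomic_innerE.
Qed.

Lemma hardy_atomic : hardy (@atomic_inner R) (dSpow 1) 1 (1 * 2).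
Proof. by rewrite atomic_innerE; exact: hardy_Spow. Qed.

Lemma conjc_mul_unit q : normc q = 1 -> q^* * q = 1.
Proof.
move=> q1; have := sqr_normcE q; rewrite q1 expr1n.
case: q {q1} => a b /= ab; rewrite /GRing.mul /= /mulc.
by apply/eqP; rewrite eq_complex /=; apply/andP; split; apply/eqP; [rewrite ab|]; ring.
Qed.

Lemma conjcX q k : (q ^+ k)^* = q^* ^+ k.
Proof. by elim: k => [|k IH]; rewrite ?expr0 ?conjc1 // !exprS conjcM IH. Qed.

Lemma conjcD z w : (z + w)^* = z^* + w^*.
Proof. by case: z w => [a b] [c d]; rewrite /= opprD. Qed.

Lemma conjc_sum (I : Type) (r : seq I) (F : I -> R[i]) :
  (\sum_(i <- r) F i)^* = \sum_(i <- r) (F i)^*.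
Proof. by elim/big_rec2: _ => [|i y x _ <-]; rewrite ?conjc0 ?conjcD. Qed.

(** The conjugate of q^n lowers the exponents n - k and n + k to - k and k, and negative powers are
    conjugates because |q| = 1. *)
Lemma conj_fejer n q : normc q = 1 ->
  (q ^+ n)^* * fejer n q =
  (\sum_(1 <= k < n) (k%:R^-1)%:C * q ^+ k)^* - \sum_(1 <= k < n) (k%:R^-1)%:C * q ^+ k.
Proof.
move=> /conjc_mul_unit qq.
have qqX k : q^* ^+ k * q ^+ k = 1 by rewrite -exprMn qq expr1n.
rewrite conjc_sum /fejer mulr_sumr -sumrB big_nat [in RHS]big_nat.
apply: eq_bigr => k /andP[k0 kn].
rewrite conjcM conjc_real !conjcX mulrCA -mulrBr; congr (_ * _).
rewrite mulrBr exprD mulrA qqX mul1r -{1}(subnKC (ltnW kn)) exprD -mulrA qqX mulr1.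
by [].
Qed.

Lemma hankel_test_fun n th : (0 < n)%N -> th \in arc ->
  hankel (fun s => (boundary (@atomic_inner R) s)^*) (boundary (test_fun n)) th =
  (log_sum n (expi th))^* - (log_sum n 0)^*.
Proof.
move=> n0 Dth.
have [h [B [M Hl]]] := hardy_log_sum n.
have [h' [B' [M' Ht]]] := hardy_test_fun n.
have uE s : s \in arc -> (boundary (@atomic_inner R) s)^* * boundary (test_fun n) s =
    (log_sum n (expi s))^* - log_sum n (expi s).
  move=> Ds; rewrite (hardy_boundaryE hardy_atomic Ds) (hardy_boundaryE Ht Ds).
  rewrite (Spow_atomic _ n0) /test_fun conj_fejer //.
  by apply: normc_Spow_circle; exact: normc_expi.
rewrite /hankel (szego_conjB Hl Dth uE) uE //.
by rewrite opprB addrA subrK.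
Qed.

(** At 0 the root is exp (- 1 / (n + 1)), and [k <= n], so each of its powers in the sum is at least
    exp (-1). *)
Lemma log_sum0_ge n : expR (-1) * \sum_(1 <= k < n.+1) k%:R^-1 <= normc (log_sum n.+1 0).
Proof.
have -> : log_sum n.+1 0 = (\sum_(1 <= k < n.+1) k%:R^-1 * expR (- (n.+1%:R^-1)) ^+ k)%:C.
  rewrite (rmorph_sum (real_complex R)); apply: eq_bigr => k _.
  by rewrite Spow_at0 rmorphM rmorphXn.
rewrite normc_real; apply: le_trans (ler_norm _).
rewrite mulr_sumr big_nat [leRHS]big_nat; apply: ler_sum => k /andP[k0 kn].
rewrite mulrC; apply: ler_wpM2l; first by rewrite invr_ge0.
rewrite -expRM_natl ler_expR mulrN lerN2 ler_pdivrMr ?ltr0n // mul1r.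
by rewrite ler_nat ltnW.
Qed.

(* If [Re q < 0], then [|1 - q| >= 1], so [log_sum] stays bounded at the boundary point
   while its value at [0] grows like the harmonic sum. *)
Lemma hankel_ge n th : th \in arc -> complex.Re (Spow n.+1%:R^-1 (expi th)) < 0 ->
  expR (-1) * \sum_(1 <= k < n.+1) k%:R^-1 - 2 <=
  normc (hankel (fun s => (boundary (@atomic_inner R) s)^*) (boundary (test_fun n.+1)) th).
Proof.
move=> Dth; set q := Spow _ _ => Req.
rewrite hankel_test_fun // -conjcB normc_conj normcB.
apply: le_trans (ler_normcB _ _); apply: lerB; first exact: log_sum0_ge.
have q1 : normc q = 1 by rewrite normc_Spow_circle // normc_expi.
have d1 : 1 <= normc (1 - q).
  apply: le_trans (normRe_le _); apply: le_trans (ler_norm _).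
  rewrite cReB; move: (complex.Re q) Req => r r0 /=; lra.
have qn1 : q != 1 by rewrite eq_sym -subr_eq0 -normc_gt0 (lt_le_trans ltr01).
apply: le_trans (log_partial_sum_le _ _ qn1) _; first by rewrite q1.
by rewrite ler_pdivrMr ?(lt_le_trans ltr01) // ler_peMr.
Qed.

End HankelBlowup.

(** * An arc on which the Hankel image is large *)

Section NotHH.
Context {R : realType}.
Implicit Types (q z w : R[i]) (c x y t th : R) (k n : nat).
Local Notation arc := `]0%R, 2 * pi[.
Local Notation mu := (@lebesgue_measure R).

(** At the angle 2 p the quotient (z + 1) / (z - 1) is - i cot p. The choice cot p = (n + 1) pi,
    made by an arctangent, turns the exponent into - i pi. *)
Lemma exists_SpowN1 n : exists2 th : R, th \in arc & Spow n.+1%:R^-1 (expi th) = -1.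
Proof.
have pi0 := @pi_gt0 R.
have n0 : (0 : R) < n.+1%:R by rewrite ltr0n.
pose p := atan (n.+1%:R * pi)^-1 : R.
have p0 : 0 < p by rewrite -atan0 lt_atan // invr_gt0 mulr_gt0.
have p2 : p < pi / 2 := atan_ltpi2 _.
have D : p + p \in arc by rewrite in_itv /=; apply/andP; split; lra.
exists (p + p) => //.
have s0 : 0 < sin p by apply: sin_gt0_pi; apply/andP; split; lra.
have c0 : 0 < cos p by apply: cos_gt0_pihalf; apply/andP; split; lra.
have cs : cos p / sin p = n.+1%:R * pi.
  by rewrite -[RHS]invrK -[in RHS](atanK (n.+1%:R * pi)^-1) -/p /tan invf_div.
have z1 : expi (p + p) - 1 != 0 :> R[i].
  by rewrite subr_eq0 expi_neq1 //; move: D; rewrite in_itv.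
have q : (expi (p + p) + 1) / (expi (p + p) - 1) = 0 -i* (cos p / sin p) :> R[i].
  apply: (mulIf z1); rewrite mulfVK //.
  have e : cos p ^+ 2 = 1 - sin p ^+ 2 by exact: cos2sin2.
  have s1 : sin p != 0 by rewrite gt_eqF.
  apply/eqP; rewrite eq_complex cReM cImM !cReB !cImB cReD cImD /= cosD sinD.
  apply/andP; split; apply/eqP.
    have -> : sin p * sin p = 1 - cos p * cos p by rewrite -!expr2 e; ring.
    by field.
  have -> : cos p * cos p = 1 - sin p * sin p by rewrite -!expr2.
  by field.
rewrite /Spow q cs (_ : _%:C * _ = 0 -i* pi); last first.
  apply/eqP; rewrite eq_complex cReMr cImMr /= mulr0 eqxx /=.
  by apply/eqP; rewrite mulrN mulKf ?pnatr_eq0.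
by rewrite /cexp /= expR0 mul1r /expi cosN sinN cospi sinpi oppr0 complexr0 rmorphN rmorph1.
Qed.

(** An essential supremum ignores single angles, so the point where the root is -1 is widened to an
    interval by continuity. *)
Lemma exists_arc_neg n : exists2 I : R * R, I.1 < I.2 &
  forall th, th \in `]I.1, I.2[ ->
    th \in arc /\ complex.Re (Spow n.+1%:R^-1 (expi th)) < 0.
Proof.
have [t0 Dt at0] := exists_SpowN1 n.
have t1 : expi t0 != 1 :> R[i] by apply: expi_neq1; move: Dt; rewrite in_itv.
have ca := cdiff_continuous (cdiff_Spow n.+1%:R^-1 t1).
have L : complex.Re (Spow n.+1%:R^-1 (expi t)) @[t --> t0] --> (-1 : R).
  rewrite (_ : -1 = complex.Re (Spow n.+1%:R^-1 (expi t0))); last by rewrite at0.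
  apply: (@cvg_Re R _ (nbhs t0) _ (fun t => Spow n.+1%:R^-1 (expi t))).
  exact: (cvg_comp _ _ (vdiff_continuous (@vdiff_expi _ t0)) ca).
have L0 : \forall t \near t0, complex.Re (Spow n.+1%:R^-1 (expi t)) < 0.
  move/cvgrPdist_lt : L => /(_ 1 ltr01); apply: filterS => t.
  by rewrite ltr_distlC addNr => /andP[].
have A0 : \forall t \near t0, t \in arc by exact: near_in_itvoo.
have /nbhs_ballP[r /= r0 h] : \forall t \near t0,
    t \in arc /\ complex.Re (Spow n.+1%:R^-1 (expi t)) < 0.
  by near=> t; split; near: t.
exists (t0 - r, t0 + r) => /=; first by lra.
move=> t; rewrite in_itv /= => /andP[h1 h2]; apply: h; rewrite /ball /= ltr_distlC.
by apply/andP.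
Unshelve. all: by end_near. Qed.

Lemma le_Linf_norm (u : R -> R[i]) (a b C : R) : a < b ->
  (forall th, th \in `]a, b[ -> th \in arc /\ C < normc (u th)) ->
  (C%:E < Linf_norm u)%E.
Proof.
move=> ab H; rewrite ltNge; apply/negP; rewrite /Linf_norm Lnorm.unlock.
have inD : `]a, b[%classic `<=` `[0, 2 * pi]%classic.
  move=> t /= /H[]; rewrite !in_itv /= => /andP[t0 t2] _.
  by rewrite !ltW.
(* Used twice: the norm unfolds to an essential supremum only on a space of positive measure, and
   the exceptional null set would have to contain the interval. *)
have posI (A : set R) : `]a, b[%classic `<=` A -> measurable (A : set (measurableTypeR R)) ->
    (0 < @circle_measure R A)%E.
  move=> IA mA; apply: (@lt_le_trans _ _ (mu `]a, b[%classic)).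
    by rewrite /= lebesgue_measure_itv /= lte_fin ab -EFinB lte_fin subr_gt0.
  rewrite /circle_measure /= /mrestr; apply: le_measure; rewrite ?inE //=.
  - exact: measurableI.
  - by move=> t It; split; [exact: IA|exact: inD].
rewrite posI //; move/ess_supP => [N [mN N0 inN]].
have : `]a, b[%classic `<=` N.
  move=> t /= /H[_ Ct]; apply: inN => /=; apply/negP.
  by rewrite -ltNge ger0_norm ?normc_ge0.
by move/posI => /(_ mN); rewrite N0 ltxx.
Qed.

Lemma atomic_inner_notin_HHinf : ~ HHinf (@atomic_inner R).
Proof.
move=> [_ [C [C0 H]]].
(* Chosen so that exp (-1) times the harmonic sum, minus 2, exceeds 6 C, where 6 bounds the test
   functions. *)
have [n Hn] := harmonic_sum_unbounded (expR 1 * (6 * C + 2)).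
have [[a b] /= ab Hab] := exists_arc_neg n.
have [h [B [M Ht]]] := hardy_test_fun (R := R) n.+1.
have := H _ (hardy_Hinf Ht); apply/negP; rewrite -ltNge.
have le6 : (Hinf_norm (test_fun n.+1 : R[i] -> R[i]) <= 6%:E)%E.
  apply: hardy_Hinf_norm Ht _ => z z1; apply: fejer_le.
  by apply: normc_Spow_le1; rewrite ?invr_ge0 // ltW.
apply: (@le_lt_trans _ _ (6 * C)%:E).
  by rewrite mulrC EFinM; apply: lee_wpmul2l => //; rewrite lee_fin ltW.
apply: (@le_Linf_norm _ a b) => // th /Hab[Dth Rth]; split=> //.
apply: lt_le_trans (hankel_ge Dth Rth).
by rewrite ltrBrDr expRN ltr_pdivlMl ?expR_gt0.
Qed.

End NotHH.

(** * Radial variation *)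

Section RadialVariation.
Context {R : realType}.
Implicit Types (a s t x k th : R) (z : R[i]).
Local Notation mu := (@lebesgue_measure R).

(** exp x = (exp (x / 2))^2 >= (1 + x / 2)^2 >= x^2 / 4. *)
Lemma expRN_le_inv_sqr x : 0 < x -> expR (- x) <= 4 * x ^- 2.
Proof.
move=> x0; rewrite expRN -[4]invrK -invfM lef_pV2 ?posrE ?expR_gt0 //; last first.
  by rewrite mulr_gt0 ?exprn_gt0 // invr_gt0.
have -> : expR x = expR (x / 2) ^+ 2 by rewrite -expRM_natl mulrC divfK.
apply: (@le_trans _ _ ((1 + x / 2) ^+ 2)).
  have := sqr_ge0 x; rewrite !expr2 => h; nra.
have h0 : 0 <= 1 + x / 2 by rewrite addr_ge0 // divr_ge0 // ltW.
by rewrite ler_pXn2r ?nnegrE ?expR_ge0 // expR_ge1Dx.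
Qed.

(* With [s = 1 - t] and [a < 1], [D] is comparable to [s ^ 2 + a]; the constant term
   dominates where [a <= s ^ 2], the exponential one elsewhere.  At [a = 0] the latter
   vanishes since [(2 * 0)^-1 = 0]. *)
Lemma radial_derivative_le a t D : 0 <= a -> 0 <= t < 1 ->
  D = (1 - t) ^+ 2 + t * a ->
  expR ((t ^+ 2 - 1) / D) * (2 / D) <=
  64 + 8 * ((2 * a)^-1 * expR ((2 * a)^-1 * (t - 1))).
Proof.
move=> a0 /andP[t0 t1] Deq.
have st : 0 < 1 - t by rewrite subr_gt0.
have rhs0 : 0 <= 8 * ((2 * a)^-1 * expR ((2 * a)^-1 * (t - 1))).
  by rewrite mulr_ge0 // mulr_ge0 ?expR_ge0 // invr_ge0 mulr_ge0.
have D0 : 0 < D by rewrite Deq ltr_pwDl ?exprn_gt0 // mulr_ge0.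
(* For [a >= 1], [D] is at least 1 - t + t^2 >= 3 / 4, and the constant term suffices. *)
have [a1|a1] := leP 1 a.
  apply: (@le_trans _ _ 64); last by rewrite lerDl.
  have D34 : 3 / 4 <= D.
    have ta : t <= t * a by rewrite ler_peMr.
    by have := sqr_ge0 (t - 2^-1); rewrite Deq !expr2; lra.
  apply: (@le_trans _ _ (1 * 64)); last by rewrite mul1r.
  apply: ler_pM; rewrite ?expR_ge0 ?divr_ge0 ?(ltW D0) //.
    rewrite -[leRHS]expR0 ler_expR mulr_le0_ge0 ?invr_ge0 ?(ltW D0) // subr_le0.
    by rewrite expr_le1 // ltW.
  by rewrite ler_pdivrMr //; lra.
pose s := 1 - t; have s0 : 0 < s by [].
have s1 : s <= 1 by rewrite /s; lra.
have ts : t = 1 - s by rewrite /s; lra.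
(* [D] is E - s a. It is at least E / 2, since 2 s a <= s^2 + a^2 <= E when a < 1. *)
pose E := s ^+ 2 + a.
have E0 : 0 < E by rewrite /E ltr_pwDl ?exprn_gt0.
have DE : D <= E by rewrite Deq /E -/s ts !expr2; nra.
have ED : E <= 2 * D by rewrite Deq /E -/s ts !expr2; have := sqr_ge0 (s - a); rewrite expr2; nra.
have step : expR ((t ^+ 2 - 1) / D) * (2 / D) <= expR (- (s / E)) * (4 / E).
  apply: ler_pM; rewrite ?expR_ge0 ?divr_ge0 ?(ltW D0) //.
    rewrite ler_expR -[(_ - 1) / _]opprK lerN2 -mulNr opprB.
    rewrite ler_pdivrMr // mulrAC ler_pdivlMr //.
    have h : s <= 1 - t ^+ 2 by rewrite ts expr2; nra.
    by apply: ler_pM => //; exact: ltW.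
  rewrite ler_pdivrMr // mulrAC ler_pdivlMr //; lra.
apply: le_trans step _.
have [as2|s2a] := leP a (s ^+ 2).
  apply: (@le_trans _ _ 64); last by rewrite lerDl.
  have s20 : 0 < s ^+ 2 by rewrite exprn_gt0.
  (* Here E <= 2 s^2, so the exponential is at most exp (- 1 / (2 s)) <= 16 s^2; against 4 / s^2
     this gives 64. *)
  apply: (@le_trans _ _ ((4 * (2 * s) ^- 1 ^- 2) * (4 / s ^+ 2))); last first.
    rewrite le_eqVlt; apply/orP; left; apply/eqP; field; exact: lt0r_neq0.
  apply: ler_pM; rewrite ?expR_ge0 ?divr_ge0 ?(ltW E0) //; last first.
    rewrite ler_pM2l // lef_pV2 ?posrE //; by rewrite /E lerDl.
  apply: le_trans (expRN_le_inv_sqr _); last by rewrite invr_gt0 mulr_gt0.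
  rewrite ler_expR lerN2 ler_pdivlMr // mulrC ler_pdivrMr ?mulr_gt0 //.
  by rewrite /E; rewrite !expr2 in as2 *; nra.
(* In this region a <= E <= 2 a: the upper bound serves the exponent, the lower one the factor 4 /
   E. *)
have a00 : 0 < a by rewrite (le_lt_trans (sqr_ge0 s)).
apply: (@le_trans _ _ (8 * ((2 * a)^-1 * expR ((2 * a)^-1 * (t - 1))))); last by rewrite lerDr.
have -> : 8 * ((2 * a)^-1 * expR ((2 * a)^-1 * (t - 1))) =
    expR (- (s / (2 * a))) * (4 / a).
  have -> : (2 * a)^-1 * (t - 1) = - (s / (2 * a)) by rewrite ts; field; exact: lt0r_neq0.
  by field; exact: lt0r_neq0.
apply: ler_pM; rewrite ?expR_ge0 ?divr_ge0 ?(ltW E0) //.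
  rewrite ler_expR lerN2 ler_pM2l // lef_pV2 ?posrE ?mulr_gt0 //.
  by rewrite /E; lra.
by rewrite ler_pM2l // lef_pV2 ?posrE // /E lerDr sqr_ge0.
Qed.

Lemma majorant_continuous k :
  continuous (fun t => 64 + 8 * (k * expR (k * (t - 1)))).
Proof.
move=> t; apply: cvgD; first exact: cvg_cst.
apply: cvgM; first exact: cvg_cst.
apply: cvgM; first exact: cvg_cst.
apply: continuous_comp; last exact: continuous_expR.
apply: cvgM; first exact: cvg_cst.
by apply: cvgB; [exact: cvg_id|exact: cvg_cst].
Qed.

Lemma cvg_normc (T : Type) (F : set_system T) {FF : Filter F} (h : T -> R[i]) z :
  h t @[t --> F] --> z -> normc (h t) @[t --> F] --> normc z.
Proof.
move=> /cvg_complexP H; apply/cvgrPdist_lt => e /H; apply: filterS => t.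
apply: le_lt_trans; rewrite ler_norml ler_normcB andbT lerNl opprB normcB.
exact: ler_normcB.
Qed.

(** [k * expR (k * (t - 1))] is the derivative of [expR (k * (t - 1))], whose increment over [0, 1]
    is at most 1 whatever [k]; hence 72 = 64 + 8, uniformly in the angle. *)
Lemma integral_majorant_le (k : R) : 0 <= k ->
  (\int[mu]_(t in `[0%R, 1%R[) (64 + 8 * (k * expR (k * (t - 1))))%:E <= 72%:E)%E.
Proof.
move=> k0.
pose f t : R := 64 + 8 * (k * expR (k * (t - 1))).
pose F t : R := 64 * t + 8 * expR (k * (t - 1)).
have dF t : is_derive (t : R) 1 F (f t).
  have d1 : is_derive (t : R) 1 (fun t => k * (t - 1)) k.
    by apply: is_derive_eq; rewrite /GRing.scale /=; ring.
  have d2 : is_derive (t : R) 1 (fun t => expR (k * (t - 1))) (expR (k * (t - 1)) * k).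
    exact: (@is_derive1_comp R expR (fun t => k * (t - 1)) t _ _ (is_derive_expR _) d1).
  apply: is_derive_eq; rewrite /GRing.scale /= /f.
  ring.
have cF : continuous F.
  by move=> t; apply/differentiable_continuous/derivable1_diffP; case: (dF t).
have cf : continuous f := @majorant_continuous k.
rewrite integral_itv_bndo_bndc; last first.
  apply/measurable_EFinP; apply: measurable_funTS; exact: continuous_measurable_fun.
rewrite (continuous_FTC2 (F := F)) //.
- rewrite -EFinB lee_fin /F subrr !mulr0 mulr1 sub0r expR0.
  by have := expR_ge0 (k * -1); lra.
- exact: continuous_subspaceT.
- split.
  + by move=> x _; case: (dF x).
  + by apply: cvg_at_right_filter; exact: cF.
  + by apply: cvg_at_left_filter; exact: cF.
- by move=> x _; rewrite derive1E; case: (dF x).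
Qed.

(** [2 * (1 - cos th)] is |1 - expi th|^2, the parameter [a] of the pointwise estimate. *)
Lemma sqr_normc_expiB1 t th :
  normc (t%:C * expi th - 1) ^+ 2 = (1 - t) ^+ 2 + t * (2 * (1 - cos th)).
Proof.
rewrite sqr_normcE /= !mul0r subr0 addr0 subr0.
have -> : (t * cos th - 1) ^+ 2 + (t * sin th) ^+ 2 =
  t ^+ 2 * (cos th ^+ 2 + sin th ^+ 2) + 1 - 2 * t * cos th by ring.
by rewrite cos2Dsin2; ring.
Qed.

Lemma normc_dSpow1 t th D : 0 <= t ->
  D = (1 - t) ^+ 2 + t * (2 * (1 - cos th)) ->
  normc (dSpow 1 (t%:C * expi th)) = expR ((t ^+ 2 - 1) / D) * (2 / D).
Proof.
move=> t0 DE; rewrite /dSpow mul1r normcM normc_Spow mul1r.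
rewrite sqr_normc_expiB1 -DE normcM normc_real normc_expi mulr1 ger0_norm //.
congr (_ * _); rewrite normcM normcN normcV normcX sqr_normc_expiB1 -DE.
by rewrite -[2 in LHS](rmorph_nat (real_complex R)) normc_real ger0_norm.
Qed.

Lemma radial_variation_atomic_le th : (radial_variation (@atomic_inner R) th <= 72%:E)%E.
Proof.
have lt1 t : -1 < t < 1 -> normc (t%:C * expi th) < 1.
  by move=> t1; rewrite normcM normc_real normc_expi mulr1 ltr_norml.
have lt1' t : t \in `[0, 1[ -> -1 < t < 1.
  by rewrite in_itv /= => /andP[t0 ->]; rewrite (lt_le_trans _ t0) // oppr_lt0.
have E t : t \in `[0, 1[ -> derive1 (@atomic_inner R) (t%:C * expi th) = dSpow 1 (t%:C * expi th).
  by move=> /lt1'/lt1 t1; apply: cdiff_derive1; exact: hardy_cdiff hardy_atomic _ t1.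
have -> : radial_variation (@atomic_inner R) th =
    (\int[mu]_(t in `[0%R, 1%R[) (normc (dSpow 1 (t%:C * expi th)))%:E)%E.
  by apply: eq_integral => t; rewrite inE /= => t01; rewrite E.
have cos1 : 0 <= 2 * (1 - cos th) by rewrite mulr_ge0 // subr_ge0 cos_le1.
have k0 : 0 <= (2 * (2 * (1 - cos th)))^-1 by rewrite invr_ge0 mulr_ge0.
(* Continuity gives measurability on an open set, so the radius is first prolonged to []-1, 1[] and
   then restricted. *)
have mD : measurable_fun (`](-1)%R, 1%R[%classic : set R)
    (fun t : R => normc (dSpow 1 (t%:C * expi th))).
  apply: open_continuous_measurable_fun; first exact: interval_open.
  move=> t; rewrite inE /= in_itv /= => /lt1 t1.
  have c := hardy_cont hardy_atomic t1.
  have v : vdiff (fun r => r%:C * expi th : R[i]) t (expi th).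
    by apply: eq_vdiff (vdiff_affine 0 (expi th) t) => r; rewrite add0r.
  have cd := cvg_comp _ _ (vdiff_continuous v) c.
  exact: (@cvg_normc _ (nbhs t) _ (fun r => dSpow 1 (r%:C * expi th)) _ cd).
apply: le_trans (integral_majorant_le k0).
apply: ge0_le_integral => //.
- by move=> t _; rewrite lee_fin normc_ge0.
- have sub : (`[0%R, 1%R[%classic : set R) `<=` `](-1)%R, 1%R[%classic.
    by move=> t /lt1'; rewrite /= in_itv.
  by apply/measurable_EFinP; exact: (measurable_funS _ sub mD).
- apply/measurable_EFinP; apply: measurable_funTS.
  exact: continuous_measurable_fun (@majorant_continuous _).
- move=> t; rewrite /= in_itv /= => /[dup] t01 /andP[t0 _].
  have e := @normc_dSpow1 t th _ t0 erefl; rewrite lee_fin.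
  apply: (le_trans _ (radial_derivative_le cos1 t01 erefl)).
  by rewrite -e lexx.
Qed.

Lemma atomic_inner_BRV : BRV (@atomic_inner R).
Proof.
split; first exact: hardy_analytic hardy_atomic.
apply: (@le_lt_trans _ _ 72%:E); last by rewrite ltry.
by apply: ge_ereal_sup => _ [th _ <-]; exact: radial_variation_atomic_le.
Qed.

End RadialVariation.

Theorem proposition2p10 (R : realType) :
  (BRV `\` HHinf) (atomic_inner : R[i] -> R[i]).
Proof. by split; [exact: atomic_inner_BRV|exact: atomic_inner_notin_HHinf]. Qed.
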